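(* There is an absolute constant $C>0$ such that, for all $s\in(0,1]$: - for expanding averaging systems whose graphs are all connected ($m=1$), $\mathcal{E}^{\mathrm{EXP}}_{1,s}\le Cd^3/(sh^2)$; - for $1\le m\le n-1$, $\mathcal{E}^{\mathrm{EXP}}_{m,s}\le (c/s)^m$ with $c=Cd^3mn/h^2$.
   Context: Fix $n\ge2$, an integer $d\ge2$ and $h>0$. Let $(G_t)_{t\ge0}$ be undirected graphs on $[n]$, each with a self-loop at every vertex. Let $M_t$ be the $0/1$ adjacency matrix of $G_t$, including the diagonal ones from the self-loops. An expanding averaging system is one in which: - every row of $M_t$ sums to $d$ (so $G_t$ is $d$-regular counting its self-loop); - every connected component of every $G_t$ has Cheeger constant at least $h$, i.e., for every set $X$ of at most half the vertices of that component, the number of edges with exactly one endpoint in $X$ is at least $h|X|$. The dynamics is $P_t=M_t/d$, $x(t+1)=P_tx(t)$. Write $q=d\mathbf{1}$. At time $t$, each edge $\{i,j\}$ of $G_t$ with $i\ne j$ is embedded as the closed interval with endpoints $x_i(t),x_j(t)$. The union of these intervals is a disjoint union of closed intervals (blocks) with lengths $l_1(t),\dots,l_{k_t}(t)$. Set $E_{s,t}=\sum_il_i(t)^s$ and $E_s=\sum_{t\ge0}E_{s,t}$. $\mathcal{E}^{\mathrm{EXP}}_{m,s}$ is the supremum of $E_s$ over all such systems in which every $G_t$ has at most $m$ connected components, and over all $x(0)$ with $\sum_iq_i(x_i(0)-\mu)^2\le1$, where $\mu=\frac1n\sum_ix_i(0)$. *)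

(* Defs.v *)
From HB Require Import structures.
From mathcomp Require Import all_boot all_order all_algebra.
From mathcomp Require Import all_classical all_reals all_analysis.
From mathcomp Require Import Rstruct.
Set Implicit Arguments. Unset Strict Implicit. Unset Printing Implicit Defensive.
Import Order.TTheory GRing.Theory Num.Theory.
Local Open Scope ring_scope.

Section Defs.
Variable R : realType.
Variable n : nat.

Definition loopy_undirected (adj : nat -> rel 'I_n) : Prop :=
  forall t, (forall i, adj t i i) /\ (forall i j, adj t i j = adj t j i).

Definition adjmx (adj : nat -> rel 'I_n) (t : nat) : 'M[R]_n :=
  \matrix_(i, j) (adj t i j)%:R.

Definition rows_sum_to (adj : nat -> rel 'I_n) (d : nat) : Prop :=
  forall t i, \sum_(j < n) adjmx adj t i j = d%:R.

Definition component (adj : nat -> rel 'I_n) (t : nat) (i : 'I_n) : {set 'I_n} :=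
  [set j | connect (adj t) i j].

Definition components (adj : nat -> rel 'I_n) (t : nat) : {set {set 'I_n}} :=
  [set component adj t i | i : 'I_n].

(* number of edges with exactly one endpoint in X (each such edge {i,j}
   counted once, oriented from i in X to j outside X) *)
Definition boundary_edges (adj : nat -> rel 'I_n) (t : nat) (X : {set 'I_n}) : nat :=
  #|[set p : 'I_n * 'I_n | [&& adj t p.1 p.2, p.1 \in X & p.2 \notin X]]|.

Definition cheeger_at_least (adj : nat -> rel 'I_n) (h : R) : Prop :=
  forall t, forall K, K \in components adj t ->
    forall X : {set 'I_n}, X \subset K -> (2 * #|X| <= #|K|)%N ->
      h * #|X|%:R <= (boundary_edges adj t X)%:R.

Definition expanding_averaging_system (adj : nat -> rel 'I_n) (d : nat) (h : R) : Prop :=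
  [/\ loopy_undirected adj, rows_sum_to adj d & cheeger_at_least adj h].

Definition at_most_components (adj : nat -> rel 'I_n) (m : nat) : Prop :=
  forall t, (#|components adj t| <= m)%N.

Definition averaging_dynamics (adj : nat -> rel 'I_n) (d : nat) (x : nat -> 'I_n -> R) : Prop :=
  forall t i, x t.+1 i = \sum_(j < n) (adjmx adj t i j / d%:R) * x t j.

Definition mean (x0 : 'I_n -> R) : R := (\sum_(i < n) x0 i) / n%:R.

Definition normalized_init (d : nat) (x0 : 'I_n -> R) : Prop :=
  \sum_(i < n) d%:R * (x0 i - mean x0) ^+ 2 <= 1.

Definition edge_union (adj : nat -> rel 'I_n) (x : nat -> 'I_n -> R) (t : nat) (y : R) : Prop :=
  exists i j, [/\ i != j, adj t i j & Num.min (x t i) (x t j) <= y <= Num.max (x t i) (x t j)].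

(* [a,b] is a block: a maximal closed interval contained in the union
   (i.e. a connected component of the finite union of closed intervals) *)
Definition is_block (U : R -> Prop) (a b : R) : Prop :=
  a <= b /\ (forall y, a <= y <= b -> U y) /\
  (forall a' b', a' <= a -> b <= b' -> (forall y, a' <= y <= b' -> U y) ->
     a' = a /\ b' = b).

(* E_{s,t} = sum over blocks of (length)^s.  Block endpoints are endpoints
   of edge intervals, hence among the values x_i(t); we sum over pairs of
   distinct values. *)
Definition Est (adj : nat -> rel 'I_n) (x : nat -> 'I_n -> R) (s : R) (t : nat) : R :=
  let vals := undup [seq x t i | i : 'I_n] in
  \sum_(a <- vals) \sum_(b <- vals)
     (if `[< is_block (edge_union adj x t) a b >] then (b - a) `^ s else 0).

Definition Es (adj : nat -> rel 'I_n) (x : nat -> 'I_n -> R) (s : R) : \bar R :=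
  (\sum_(0 <= t <oo) (Est adj x s t)%:E)%E.

End Defs.

(* Main.v *)
Require Import Defs.
From HB Require Import structures.
From mathcomp Require Import all_boot all_order all_algebra.
From mathcomp Require Import all_classical all_reals all_analysis.
From mathcomp Require Import Rstruct.
(* Re-imported so that [set0], [subsetP], etc. denote the finite-set versions. *)
From mathcomp Require Import fintype finset.
From mathcomp Require Import ring lra zify.
Set Implicit Arguments. Unset Strict Implicit. Unset Printing Implicit Defensive.
Import Order.TTheory GRing.Theory Num.Theory.
Local Open Scope ring_scope.

(** Write [sqdev x S] for the sum of squared deviations of [x] from its mean on [S].
Averaging over a regular graph with self-loops lowers [sqdev x S], for every [S] without
outgoing edges, by at least the sum of [sqdev x K / A] over the connected components [K]
of [S], where [A = 4 d^3 / h^2] comes from Cheeger's inequality. A block is no longer than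
the total diameter of its components, so, with [sigma = s / 2], it suffices to bound the
sum over all times and components of [sqdev x K ^ sigma].

For at most [k] components on [N] vertices this sum is at most
[(B N)^k (sqdev x S)^sigma] with [B] of order [A k / s], by induction on [k] and on time.
Either the components already account for a fraction [1 / (4 k N)] of [sqdev x S], which
then drops at once, or by Cauchy-Schwarz some gap [g] between blocks splits [S] into [L]
and [R] with [4 k^2 g^2 |L| |R| >= N sqdev x S]. Until an edge crosses the gap, [L] and [R]
evolve independently with at most [k - 1] components each; averaging shrinks convex hulls,
so the gap does not narrow, and the first crossing edge makes [sqdev x S] drop by at least
[g^2 / (2 A)]. *)

(** * Squared deviations and connected components *)

Section SquaredDeviation.
Variables (R : realFieldType) (V : finType).
Implicit Types (y : V -> R) (S K L : {set V}).

Definition avg y S : R := (\sum_(i in S) y i) / #|S|%:R.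
Definition sqdev y S : R := \sum_(i in S) (y i - avg y S) ^+ 2.

Lemma sum_avg y S : \sum_(i in S) y i = #|S|%:R * avg y S.
Proof.
rewrite /avg mulrC; have [->|S0] := eqVneq S set0.
  by rewrite big_set0 mul0r mul0r.
by rewrite divfK // pnatr_eq0 cards_eq0.
Qed.

(** Parallel-axis identity: the cross term vanishes because deviations from the mean sum to zero. *)
Lemma sum_sqr_shift y S c :
  \sum_(i in S) (y i - c) ^+ 2 = sqdev y S + #|S|%:R * (avg y S - c) ^+ 2.
Proof.
set a := avg y S.
have -> : \sum_(i in S) (y i - c) ^+ 2 = \sum_(i in S) ((y i - a) ^+ 2 +
    (2 * (a - c) * y i + (- 2 * (a - c) * a + (a - c) ^+ 2))).
  by apply: eq_bigr => i _; ring.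
rewrite big_split /= -/(sqdev y S) big_split /= -mulr_sumr sum_avg sumr_const -/a.
by rewrite -[X in _ + (_ + X)]mulr_natr; ring.
Qed.

Lemma sqdev_ge0 y S : 0 <= sqdev y S.
Proof. by apply: sumr_ge0 => i _; apply: sqr_ge0. Qed.

Lemma sqdev_le_sum y S c : sqdev y S <= \sum_(i in S) (y i - c) ^+ 2.
Proof. by rewrite sum_sqr_shift lerDl mulr_ge0 ?ler0n ?sqr_ge0. Qed.

Lemma sqdevE y S : sqdev y S = \sum_(i in S) y i ^+ 2 - #|S|%:R * avg y S ^+ 2.
Proof.
have := sum_sqr_shift y S 0; rewrite subr0.
by under eq_bigr do rewrite subr0; move=> ->; ring.
Qed.

Lemma sqdevS y K S : K \subset S -> sqdev y K <= sqdev y S.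
Proof.
move=> KS; apply: le_trans (sqdev_le_sum y K (avg y S)) _.
rewrite /sqdev [leRHS](big_setID K) /= (setIidPr KS) lerDl.
by apply: sumr_ge0 => i _; apply: sqr_ge0.
Qed.

(** Parallel-axis identity centred at [y i], summed over [i] in [S]. *)
Lemma sum_pairs_sqdev y S :
  \sum_(i in S) \sum_(j in S) (y i - y j) ^+ 2 = 2 * #|S|%:R * sqdev y S.
Proof.
have -> : \sum_(i in S) \sum_(j in S) (y i - y j) ^+ 2 =
    \sum_(i in S) (sqdev y S + #|S|%:R * (y i - avg y S) ^+ 2).
  apply: eq_bigr => i _.
  rewrite -[(y i - _) ^+ 2]sqrrN opprB -sum_sqr_shift.
  by apply: eq_bigr => j _; rewrite -sqrrN opprB.
by rewrite big_split /= -mulr_sumr sumr_const -/(sqdev y S) -[X in X + _]mulr_natr; ring.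
Qed.

(** The deviations [u], [v] of two distinct vertices are two terms of [sqdev], and
    [(u - v)^2 <= 2 u^2 + 2 v^2]. *)
Lemma sqdev_diam y S i j :
  i \in S -> j \in S -> (y i - y j) ^+ 2 <= 2 * sqdev y S.
Proof.
move=> iS jS; have [->|ij] := eqVneq i j.
  by rewrite subrr expr0n mulr_ge0 ?sqdev_ge0.
rewrite /sqdev (bigD1 i) //= (bigD1 j) /=; last by rewrite jS eq_sym.
set r := (X in _ + (_ + X)).
have : 0 <= r by apply: sumr_ge0 => k _; apply: sqr_ge0.
move: (avg y S) => a.
move=> r0; rewrite -subr_ge0.
have -> : 2 * ((y i - a) ^+ 2 + ((y j - a) ^+ 2 + r)) - (y i - y j) ^+ 2 =
    ((y i - a) + (y j - a)) ^+ 2 + 2 * r by ring.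
by rewrite addr_ge0 ?sqr_ge0 ?mulr_ge0.
Qed.

End SquaredDeviation.

(** * Connected components and unions of components *)

Section Components.
Variables (V : finType) (e : rel V).
Hypothesis e_sym : symmetric e.
Implicit Types (S K L : {set V}).

Definition conn_comp (i : V) : {set V} := [set j | connect e i j].
Definition conn_comps : {set {set V}} := [set conn_comp i | i : V].
Definition comps_in S : {set {set V}} := [set K in conn_comps | K \subset S].
(** For symmetric [e], exactly the unions of connected components; the Boolean equality makes
    passing to complements immediate. *)
Definition stable S := forall i j, e i j -> (i \in S) = (j \in S).

Lemma mem_comp i : i \in conn_comp i.
Proof. by rewrite inE connect0. Qed.

Lemma comp_eq i j : j \in conn_comp i -> conn_comp i = conn_comp j.
Proof.
rewrite inE => ij; apply/setP => k; rewrite !inE.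
exact: (same_connect (sym_connect_sym e_sym)).
Qed.

Lemma stable_connect S i j : stable S -> connect e i j -> (i \in S) = (j \in S).
Proof. by move=> st; apply: closed_connect. Qed.

Lemma stable_comp i : stable (conn_comp i).
Proof.
move=> j k jk; rewrite !inE; apply: (same_connect_r (sym_connect_sym e_sym)).
exact: connect1.
Qed.

Lemma comp_subset S i : stable S -> (conn_comp i \subset S) = (i \in S).
Proof.
move=> st; apply/subsetP/idP => [|iS j]; first by apply; apply: mem_comp.
by rewrite inE => /(stable_connect st) <-.
Qed.

Lemma comps_inP S K : stable S ->
  reflect (exists2 i, i \in S & K = conn_comp i) (K \in comps_in S).
Proof.
move=> st; rewrite inE; apply: (iffP andP) => [[/imsetP[i _ ->]]|[i iS ->]].
  by rewrite comp_subset //; exists i.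
by rewrite comp_subset // iS; split=> //; apply/imsetP; exists i.
Qed.

Lemma sum_comps (M : nmodType) S (f : V -> M) : stable S ->
  \sum_(K in comps_in S) \sum_(i in K) f i = \sum_(i in S) f i.
Proof.
move=> st; rewrite [RHS](partition_big conn_comp (mem (comps_in S))) /=; last first.
  by move=> i iS; apply/comps_inP => //; exists i.
apply: eq_bigr => K /(comps_inP _ st)[i iS ->]; apply: eq_bigl => j.
apply/idP/andP => [ij|[_ /eqP <-]]; last exact: mem_comp.
rewrite -(comp_eq ij) eqxx; split=> //.
by move: ij; rewrite inE => /(stable_connect st) <-.
Qed.

Lemma comps_in_gt0 S i : stable S -> i \in S -> (0 < #|comps_in S|)%N.
Proof.
by move=> st iS; apply/card_gt0P; exists (conn_comp i); apply/comps_inP => //; exists i.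
Qed.

Lemma card_comps_in S : stable S -> (#|comps_in S| <= #|S|)%N.
Proof.
move=> st; apply: leq_trans (leq_imset_card conn_comp S).
by apply/subset_leq_card/subsetP => K /(comps_inP _ st)[i iS ->]; apply: imset_f.
Qed.

Lemma stableD S L : stable S -> stable L -> stable (S :\: L).
Proof. by move=> sS sL i j ij; rewrite !inE (sS _ _ ij) (sL _ _ ij). Qed.

Lemma comps_inU S L : stable S -> stable L -> L \subset S ->
  comps_in S = comps_in L :|: comps_in (S :\: L).
Proof.
move=> sS sL LS; have sD := stableD sS sL; apply/setP => K; rewrite in_setU.
apply/(comps_inP _ sS)/orP => [[i iS ->]|].
  case: (boolP (i \in L)) => iL; [left|right]; apply/comps_inP => //; exists i => //.
  by rewrite inE iL.
case=> /comps_inP[] // i iL ->; exists i => //; first exact: (subsetP LS).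
by move: iL; rewrite inE => /andP[].
Qed.

Lemma comps_in_disjoint S L : stable S -> stable L ->
  [disjoint comps_in L & comps_in (S :\: L)].
Proof.
move=> sS sL; apply/pred0P => K; apply/negbTE/andP => -[/=].
move=> /(comps_inP _ sL)[i iL ->]; rewrite inE comp_subset; last exact: stableD.
by rewrite inE iL andbF.
Qed.

Lemma sum_comps_inU (M : nmodType) S L (f : {set V} -> M) :
  stable S -> stable L -> L \subset S ->
  \sum_(K in comps_in S) f K =
  \sum_(K in comps_in L) f K + \sum_(K in comps_in (S :\: L)) f K.
Proof.
move=> sS sL LS; rewrite -bigU /=; last exact: comps_in_disjoint.
by apply: eq_bigl => K; rewrite (comps_inU sS sL LS) in_setU.
Qed.

Lemma card_comps_inU S L : stable S -> stable L -> L \subset S ->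
  #|comps_in S| = (#|comps_in L| + #|comps_in (S :\: L)|)%N.
Proof.
move=> sS sL LS; rewrite (comps_inU sS sL LS) cardsU.
move: (comps_in_disjoint sS sL); rewrite -setI_eq0 => /eqP ->.
by rewrite cards0 subn0.
Qed.

End Components.

(** * Cheeger inequality and dissipation *)

Lemma exists_min (R : realFieldType) (V : finType) (f : V -> R) (S : {set V}) :
  S != set0 -> exists2 i, i \in S & forall j, j \in S -> f i <= f j.
Proof. by move=> /set0Pn[k kS]; case: (arg_minP f kS) => i iS H; exists i. Qed.

(** The median is the least value having at most half of [K] strictly above it. By minimality the
    next smaller value has more than half of [K] above it, which leaves less than half for the
    vertices below the median. *)
Lemma exists_median (R : realFieldType) (V : finType) (f : V -> R) (K : {set V}) :
  exists c, (2 * #|[set i in K | (c < f i)%R]| <= #|K|)%N /\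
            (2 * #|[set i in K | (f i < c)%R]| <= #|K|)%N.
Proof.
pose above (r : R) := [set i in K | r < f i].
pose Q := [set i in K | (2 * #|above (f i)| <= #|K|)%N].
have [K0|K0] := eqVneq K set0.
  by exists 0; split; rewrite -[leqRHS]muln1 ?K0;
    (have -> : forall P : pred V, [set i in set0 | P i] = set0 :> {set V}
       by move=> P; apply/setP=> i; rewrite !inE); rewrite cards0.
have [i iQ imin] : exists2 i, i \in Q & forall j, j \in Q -> f i <= f j.
  apply: exists_min; apply/set0Pn.
  have [k kK kmax] := exists_min (fun j => - f j) K0.
  exists k; rewrite inE kK /=.
  have -> : above (f k) = set0.
    apply/setP => j; rewrite !inE; apply/negbTE/negP => /andP[jK].
    by have := kmax _ jK; lra.
  by rewrite cards0 muln0.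
exists (f i); split; first by move: iQ; rewrite inE => /andP[].
set B := [set j in K | f j < f i].
have [->|B0] := eqVneq B set0; first by rewrite cards0 muln0.
have [k kB kmax] := exists_min (fun j => - f j) B0.
move: (kB); rewrite inE => /andP[kK ki].
have kQ : k \notin Q by apply/negP => /imin; lra.
(* [k] carries the largest value below the median, so the vertices of [K] not above [f k] are
   exactly those of [B]. *)
have HB : #|K| = (#|B| + #|above (f k)|)%N.
  rewrite -(cardsID B K); congr (_ + _)%N; apply: eq_card => j; rewrite !inE.
    by case: (j \in K).
  case jK: (j \in K); rewrite ?andbF //= andbT -leNgt; apply/idP/idP => H.
    by lra.
  rewrite leNgt; apply/negP => ji.
  have jB : j \in B by rewrite inE jK.
  by have := kmax _ jB; lra.
by move: kQ; rewrite inE kK /= -ltnNge HB !mul2n -!addnn; lia.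
Qed.

Lemma sqr_pos_neg (R : realFieldType) (a : R) :
  Num.max 0 a ^+ 2 + Num.max 0 (- a) ^+ 2 = a ^+ 2.
Proof.
case: (leP a 0) => a0; first by rewrite expr0n add0r max_r ?oppr_ge0 // sqrrN.
by rewrite max_l ?oppr_le0 ?(ltW a0) // expr0n addr0.
Qed.

(** The difference of the two sides is twice the positive part of [a] times the negative part of
    [b], plus the same with [a] and [b] exchanged. *)
Lemma sqr_pos_neg_sub (R : realFieldType) (a b : R) :
  (Num.max 0 a - Num.max 0 b) ^+ 2 + (Num.max 0 (- a) - Num.max 0 (- b)) ^+ 2
  <= (a - b) ^+ 2.
Proof.
have maxN (c : R) : Num.max 0 (- c) = Num.max 0 c - c.
  case: (leP c 0) => c0; first by rewrite sub0r max_r // oppr_ge0.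
  by rewrite subrr max_l // oppr_le0 ltW.
have max0 (c : R) : 0 <= Num.max 0 c by rewrite le_max lexx.
have maxM (c : R) : Num.max 0 c * (Num.max 0 c - c) = 0.
  by case: (leP c 0) => _; rewrite ?mul0r // subrr mulr0.
rewrite !maxN.
have Ha := max0 a; have Hb := max0 b; have Ha' := max0 (- a); have Hb' := max0 (- b).
have Pa := maxM a; have Pb := maxM b.
rewrite !maxN in Ha' Hb'.
move: (Num.max 0 a) (Num.max 0 b) Ha Hb Ha' Hb' Pa Pb => p q p0 q0 pa qb Pa Pb.
have pq : 0 <= p * (q - b) by rewrite mulr_ge0.
have qp : 0 <= q * (p - a) by rewrite mulr_ge0.
rewrite -subr_ge0.
have -> : (a - b) ^+ 2 - ((p - q) ^+ 2 + (p - a - (q - b)) ^+ 2) =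
  2 * (p * (q - b)) + 2 * (q * (p - a)) - 2 * (p * (p - a)) - 2 * (q * (q - b)) by ring.
by rewrite Pa Pb; lra.
Qed.

Section Cheeger.
Variables (R : realFieldType) (V : finType) (e : rel V) (d : nat).
Hypothesis e_sym : symmetric e.
Definition nbrs (i : V) : {set V} := [set j | e i j].
Hypothesis deg : forall i, #|nbrs i| = d.
Implicit Types (f y x : V -> R) (X K S : {set V}).

(** The size of the edge boundary, written as an edge sum so that it can be compared termwise with
    other edge sums. *)
Definition outflow X : R := \sum_i \sum_(j in nbrs i) ((i \in X) && (j \notin X))%:R.
(** Each edge between distinct vertices is counted in both directions: twice the usual Dirichlet
    form. *)
Definition dirichlet y : R := \sum_i \sum_(j in nbrs i) (y i - y j) ^+ 2.

Lemma edge_sum_swap S (F : V -> V -> R) : stable e S ->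
  \sum_(i in S) \sum_(j in nbrs i) F i j = \sum_(i in S) \sum_(j in nbrs i) F j i.
Proof.
move=> st; rewrite (exchange_big_dep (mem S)) /=; last first.
  by move=> i j iS; rewrite inE => /st <-.
apply: eq_bigr => i iS; apply: eq_bigl => j; rewrite !inE e_sym.
by case: (boolP (e i j)) => [/st|]; rewrite ?andbF // andbT => <-.
Qed.

Lemma edge_sum_target S f : stable e S ->
  \sum_(i in S) \sum_(j in nbrs i) f j = d%:R * \sum_(i in S) f i.
Proof.
move=> st; rewrite (edge_sum_swap (fun _ j => f j) st) mulr_sumr.
by apply: eq_bigr => i _; rewrite sumr_const deg mulr_natl.
Qed.

Lemma edge_sum_target_all f :
  \sum_i \sum_(j in nbrs i) f j = d%:R * \sum_i f i.
Proof.
have := @edge_sum_target setT f (fun i j _ => etrans (in_setT _) (esym (in_setT _))).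
move=> H; transitivity (\sum_(i in [set: V]) \sum_(j in nbrs i) f j).
  by apply: eq_bigl => i; rewrite inE.
by rewrite H; congr (_ * _); apply: eq_bigl => i; rewrite inE.
Qed.

Lemma edge_sum_source_all f :
  \sum_i \sum_(j in nbrs i) f i = d%:R * \sum_i f i.
Proof.
by rewrite mulr_sumr; apply: eq_bigr => i _; rewrite sumr_const deg mulr_natl.
Qed.

(** Layer-cake argument by induction on the support [X] of [f]. Removing the smallest positive value
    [f k] from all of [X] lowers the left side by [h * f k * #|X|] and the right side by
    [f k * outflow X], and shrinks the support. *)
Lemma coarea X0 h f :
    (forall X, X \subset X0 -> h * #|X|%:R <= outflow X) ->
    (forall i, 0 <= f i) -> (forall i, i \notin X0 -> f i = 0) ->
  h * \sum_i f i <= \sum_i \sum_(j in nbrs i) Num.max 0 (f i - f j).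
Proof.
move=> Hh; have [n] := ubnP #|[set i | 0 < f i]|.
elim: n f => // n IH f; set X := [set i | _] => Xn f0 fX.
have fE i : i \notin X -> f i = 0.
  by rewrite inE -leNgt => H; apply/eqP; rewrite eq_le H f0.
have [X00|X0n] := eqVneq X set0.
  rewrite big1 ?mulr0; last by move=> i _; apply: fE; rewrite X00 inE.
  by apply: sumr_ge0 => i _; apply: sumr_ge0 => j _; rewrite le_max lexx.
have [k kX kmin] := exists_min f X0n.
have dp : 0 < f k by move: kX; rewrite inE.
pose g i := if i \in X then f i - f k else 0.
have gE i : f i = g i + f k * (i \in X)%:R.
  rewrite /g; case: ifP => [_|/negbT/fE ->]; first by rewrite mulr1 subrK.
  by rewrite mulr0 addr0.
have g0 i : 0 <= g i by rewrite /g; case: ifP => // /kmin; rewrite subr_ge0.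
have XX0 : X \subset X0.
  apply/subsetP => i; apply: contraLR => /fX fi; by rewrite inE fi ltxx.
have {IH} := IH g _ g0 _.
have gX : [set i | 0 < g i] \subset X :\ k.
  apply/subsetP => i; rewrite !inE /g; case: ifP => [iX|]; last by rewrite ltxx.
  move: iX; rewrite inE => ->; rewrite andbT subr_gt0; apply: contraTneq => ->.
  by rewrite ltxx.
have cg : (#|[set i | (0 < g i)%R]| < n)%N.
  apply: leq_ltn_trans (subset_leq_card gX) _.
  by move: Xn; rewrite (cardsD1 k X) kX.
move=> /(_ cg) {cg gX} IH.
have {}IH := IH (fun i iX0 => ifN _ _ (contraNN (subsetP XX0 i) iX0)).
have -> : \sum_i f i = \sum_i g i + f k * #|X|%:R.
  under eq_bigr do rewrite gE; rewrite big_split /= -mulr_sumr.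
  by rewrite -natr_sum -sum1_card; congr (_ + _ * _%:R); rewrite [RHS]big_mkcond.
have -> : \sum_i \sum_(j in nbrs i) Num.max 0 (f i - f j) =
    \sum_i \sum_(j in nbrs i) Num.max 0 (g i - g j) + f k * outflow X.
  rewrite mulr_sumr -big_split /=; apply: eq_bigr => i _.
  rewrite mulr_sumr -big_split /=; apply: eq_bigr => j _.
  rewrite /g; case: (boolP (i \in X)) => iX; case: (boolP (j \in X)) => jX /=.
  - by rewrite mulr0 addr0 opprB addrA subrK.
  - rewrite (fE _ jX) !subr0 mulr1; have fki := kmin _ iX.
    by rewrite !max_r ?subr_ge0 ?f0 // subrK.
  - rewrite (fE _ iX) mulr0 addr0 !sub0r !max_l // ?oppr_le0 ?f0 // subr_ge0.
    exact: kmin.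
  - by rewrite (fE _ iX) (fE _ jX) mulr0 addr0.
have := Hh _ XX0; nra.
Qed.

(** [coarea] for [y^2], with each [y i ^+ 2 - y j ^+ 2] factored and split by AM-GM. *)
Lemma cheeger_supported X0 h y : 0 < h -> (0 < d)%N ->
    (forall X, X \subset X0 -> h * #|X|%:R <= outflow X) ->
    (forall i, 0 <= y i) -> (forall i, i \notin X0 -> y i = 0) ->
  h ^+ 2 * \sum_i y i ^+ 2 <= 4 * d%:R * dirichlet y.
Proof.
move=> h0 d0 Hh y0 yX.
have D0 : 0 < d%:R :> R by rewrite ltr0n.
have := @coarea X0 h (fun i => y i ^+ 2) Hh (fun i => sqr_ge0 _).
move=> /(_ (fun i iX => etrans (congr1 (fun r => r ^+ 2) (yX i iX)) (expr0n _ 2))) H.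
(* With this weight the second AM-GM term, [4 b d] times the sum of squares, is exactly half of the
   left side and can be absorbed. *)
set b := h / (8 * d%:R).
have b0 : 0 < b by rewrite divr_gt0 // mulr_gt0.
have b4 : 0 <= (4 * b)^-1 by rewrite invr_ge0 mulr_ge0 // ltW.
have {}H : h * \sum_i y i ^+ 2 <= (4 * b)^-1 * dirichlet y + b * (4 * d%:R * \sum_i y i ^+ 2).
  apply: le_trans H _.
  have -> : 4 * d%:R * \sum_i y i ^+ 2 =
      \sum_i \sum_(j in nbrs i) (2 * y i ^+ 2 + 2 * y j ^+ 2).
    under [RHS]eq_bigr do rewrite big_split /=.
    rewrite big_split /= (edge_sum_target_all (fun j => 2 * y j ^+ 2)).
    by rewrite (edge_sum_source_all (fun j => 2 * y j ^+ 2)) -mulr_sumr; ring.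
  rewrite !mulr_sumr -big_split /=; apply: ler_sum => i _.
  rewrite !mulr_sumr -big_split /=; apply: ler_sum => j _.
  rewrite ge_max; apply/andP; split.
    by rewrite addr_ge0 // mulr_ge0 ?(ltW b0) ?sqr_ge0 // addr_ge0 // mulr_ge0 ?sqr_ge0.
  (* AM-GM: [2 u v <= u^2 / (2b) + 2b v^2] for [u = y i - y j], [v = y i + y j] *)
  rewrite -subr_ge0.
  have -> : (4 * b)^-1 * (y i - y j) ^+ 2 + b * (2 * y i ^+ 2 + 2 * y j ^+ 2) -
      (y i ^+ 2 - y j ^+ 2) = (4 * b)^-1 * (y i - y j - 2 * b * (y i + y j)) ^+ 2 +
      b * (y i - y j) ^+ 2.
    by field; rewrite gt_eqF.
  by rewrite addr_ge0 // mulr_ge0 ?sqr_ge0 // ltW.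
have {}H : h / 2 * \sum_i y i ^+ 2 <= (4 * b)^-1 * dirichlet y.
  have E : b * (4 * d%:R * \sum_i y i ^+ 2) = h / 2 * \sum_i y i ^+ 2.
    by rewrite /b; field; rewrite gt_eqF.
  by move: H; rewrite E; lra.
have := ler_wpM2l (ltW (mulr_gt0 (ltr0n _ 2) h0)) H.
have -> : 2 * h * (h / 2 * \sum_i y i ^+ 2) = h ^+ 2 * \sum_i y i ^+ 2 by field.
have -> // : 2 * h * ((4 * b)^-1 * dirichlet y) = 4 * d%:R * dirichlet y.
by rewrite /b; field; rewrite !gt_eqF.
Qed.

(** Cutting at a median [c], the positive and negative parts [y], [z] of [x - c] each live on at
    most half of [K], where expansion applies. Their squares add up to those of [x - c], and their
    Dirichlet forms add up to at most that of [x]. *)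
Lemma cheeger_component h K x : 0 < h -> (0 < d)%N -> stable e K ->
    (forall X, X \subset K -> (2 * #|X| <= #|K|)%N -> h * #|X|%:R <= outflow X) ->
  h ^+ 2 * sqdev x K <= 4 * d%:R * \sum_(i in K) \sum_(j in nbrs i) (x i - x j) ^+ 2.
Proof.
move=> h0 d0 st Hh; have [c [c1 c2]] := exists_median x K.
pose y i := if i \in K then Num.max 0 (x i - c) else 0.
pose z i := if i \in K then Num.max 0 (c - x i) else 0.
have Hy : h ^+ 2 * \sum_i y i ^+ 2 <= 4 * d%:R * dirichlet y.
  apply: (@cheeger_supported [set i in K | c < x i]) => //.
  - move=> X XX; apply: Hh; last first.
      by apply: leq_trans c1; rewrite leq_mul2l /=; apply: subset_leq_card.
    by apply: subset_trans XX _; apply/subsetP => i; rewrite inE => /andP[].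
  - by move=> i; rewrite /y; case: ifP => // _; rewrite le_max lexx.
  - move=> i; rewrite inE /y; case: (i \in K) => //=; rewrite -leNgt => ci.
    by rewrite max_l // subr_le0.
have Hz : h ^+ 2 * \sum_i z i ^+ 2 <= 4 * d%:R * dirichlet z.
  apply: (@cheeger_supported [set i in K | x i < c]) => //.
  - move=> X XX; apply: Hh; last first.
      by apply: leq_trans c2; rewrite leq_mul2l /=; apply: subset_leq_card.
    by apply: subset_trans XX _; apply/subsetP => i; rewrite inE => /andP[].
  - by move=> i; rewrite /z; case: ifP => // _; rewrite le_max lexx.
  - move=> i; rewrite inE /z; case: (i \in K) => //=; rewrite -leNgt => ci.
    by rewrite max_l // subr_le0.
have Eyz : \sum_i y i ^+ 2 + \sum_i z i ^+ 2 = \sum_(i in K) (x i - c) ^+ 2.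
  rewrite -big_split /= [RHS]big_mkcond /=; apply: eq_bigr => i _; rewrite /y /z.
  case: ifP => _; last by rewrite !expr0n /= addr0.
  by rewrite -[c - x i]opprB sqr_pos_neg.
have Dyz : dirichlet y + dirichlet z <= \sum_(i in K) \sum_(j in nbrs i) (x i - x j) ^+ 2.
  rewrite -big_split /= [leRHS]big_mkcond /=; apply: ler_sum => i _.
  rewrite -big_split /=.
  case: (boolP (i \in K)) => iK; last first.
    rewrite big1 // => j; rewrite inE => /st ij.
    by rewrite /y /z -ij (negbTE iK) !subrr expr0n addr0.
  apply: ler_sum => j; rewrite inE => /st ij; rewrite /y /z -ij iK.
  rewrite -[c - x i]opprB -[c - x j]opprB; apply: le_trans (sqr_pos_neg_sub _ _) _.
  by rewrite opprB addrA subrK.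
apply: le_trans (_ : _ <= 4 * d%:R * (dirichlet y + dirichlet z)) _.
  apply: le_trans (ler_wpM2l (sqr_ge0 h) (sqdev_le_sum x K c)) _.
  by rewrite -Eyz; lra.
by apply: ler_wpM2l Dyz; rewrite mulr_ge0.
Qed.

(** Among all ordered pairs in [N], those containing [i] already contribute twice the star at
    [i]. *)
Lemma sqdev_star (i : V) (N : {set V}) x : i \in N ->
  \sum_(j in N) (x i - x j) ^+ 2 <= #|N|%:R * sqdev x N.
Proof.
move=> iN; rewrite -(ler_pM2l (ltr0n R 2)) mulrA -sum_pairs_sqdev.
rewrite [leRHS](bigD1 i) //= mulr2n mulrDl mul1r lerD2l.
rewrite (bigD1 i) //= subrr expr0n add0r; apply: ler_sum => j /andP[jN ji].
rewrite (bigD1 i) //= -sqrrN opprB lerDl.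
by apply: sumr_ge0 => k _; apply: sqr_ge0.
Qed.

(** The loss of [d^2 * sqdev] is exactly [d] times the sum of [sqdev] over the neighbourhoods. The
    self-loop puts [i] in its own neighbourhood, so [sqdev_star] bounds each term below. *)
Lemma sqdev_dissipation S x x' : (0 < d)%N -> reflexive e -> stable e S ->
    (forall i, x' i = (\sum_(j in nbrs i) x j) / d%:R) ->
  d%:R ^+ 2 * sqdev x' S <=
  d%:R ^+ 2 * sqdev x S - \sum_(i in S) \sum_(j in nbrs i) (x i - x j) ^+ 2.
Proof.
move=> d0 e_refl st Hx'; have D0 : 0 < d%:R :> R by rewrite ltr0n.
have x'avg i : x' i = avg x (nbrs i) by rewrite Hx' /avg deg.
(* The mean is conserved: each vertex of [S] is averaged into exactly [d] vertices, all in [S]. *)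
have EA : avg x' S = avg x S.
  rewrite /avg; congr (_ / _); under eq_bigr do rewrite Hx'.
  rewrite -mulr_suml edge_sum_target // mulrC mulrA mulVf ?mul1r //.
  by rewrite gt_eqF.
rewrite !sqdevE EA !mulrBr [leRHS]addrAC lerD2r -subr_ge0.
have -> : d%:R ^+ 2 * \sum_(i in S) x i ^+ 2 -
    \sum_(i in S) \sum_(j in nbrs i) (x i - x j) ^+ 2 -
    d%:R ^+ 2 * \sum_(i in S) x' i ^+ 2 =
    \sum_(i in S) (d%:R * sqdev x (nbrs i) - \sum_(j in nbrs i) (x i - x j) ^+ 2).
  rewrite sumrB addrAC; congr (_ - _).
  rewrite expr2 -!mulrA -(edge_sum_target (fun i => x i ^+ 2) st) !mulr_sumr -sumrB.
  by apply: eq_bigr => i _; rewrite sqdevE deg x'avg; ring.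
apply: sumr_ge0 => i _; rewrite subr_ge0 -(deg i); apply: sqdev_star.
by rewrite inE.
Qed.

End Cheeger.

(** * Diameters and gaps *)

Section Covering.
Variables (R : realFieldType) (V : finType).
Implicit Types (y : V -> R) (S K L : {set V}) (P : {set {set V}}) (r : R).

(** The maximum of [y] on [K], with default 0 for empty [K]. *)
Definition hi y K : R :=
  if [pick i in K | [forall (j | j \in K), y j <= y i]] is Some i then y i else 0.
Definition lo y K : R := - hi (fun i => - y i) K.
Definition diam y K : R := hi y K - lo y K.

Lemma hiP y K : K != set0 ->
  exists i, [/\ i \in K, hi y K = y i & forall j, j \in K -> y j <= y i].
Proof.
move=> K0; rewrite /hi; case: pickP => [i /andP[iK /forall_inP H]|H].
  by exists i.
have [k kK kmax] := exists_min (fun j => - y j) K0.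
have /negbT/negP[] := H k; rewrite kK; apply/forall_inP => j /kmax.
by rewrite lerN2.
Qed.

Lemma le_hi y K i : i \in K -> y i <= hi y K.
Proof.
move=> iK; have /(hiP y)[j [_ -> H]] : K != set0 by apply/set0Pn; exists i.
exact: H.
Qed.

Lemma loP y K : K != set0 -> exists2 i, i \in K & lo y K = y i.
Proof.
move=> /(hiP (fun i => - y i))[i [iK E _]].
by exists i; rewrite // /lo E opprK.
Qed.

Lemma ge_lo y K i : i \in K -> lo y K <= y i.
Proof. by move=> iK; rewrite /lo lerNl; apply: (le_hi (fun j => - y j)). Qed.

Lemma diam_ge0 y K : K != set0 -> 0 <= diam y K.
Proof.
move=> /set0Pn[i iK]; rewrite /diam subr_ge0.
exact: le_trans (ge_lo y iK) (le_hi y iK).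
Qed.

Lemma diam_sqdev y K : K != set0 -> diam y K ^+ 2 <= 2 * sqdev y K.
Proof.
move=> K0; have [i [iK E _]] := hiP y K0; have [j jK E'] := loP y K0.
by rewrite /diam E E'; apply: sqdev_diam.
Qed.

(** The default [r], taken when no value lies above [r], makes the corresponding gap zero. *)
Definition next_value y S r : R :=
  if [pick v in S | (r < y v) && [forall (w | (w \in S) && (r < y w)), y v <= y w]]
    is Some v then y v else r.

Lemma next_ge y S r : r <= next_value y S r.
Proof. by rewrite /next_value; case: pickP => // v /and3P[_ /ltW]. Qed.

Lemma nextP y S r v : v \in S -> r < y v ->
  exists w, [/\ w \in S, r < y w, next_value y S r = y w &
    forall u, u \in S -> r < y u -> y w <= y u].
Proof.
move=> vS rv; rewrite /next_value; case: pickP => [w /and3P[wS rw /forall_inP H]|H].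
  by exists w; split=> // u uS ru; apply: H; rewrite uS.
have /(exists_min y)[w] : [set w in S | r < y w] != set0.
  by apply/set0Pn; exists v; rewrite inE vS.
rewrite inE => /andP[wS rw] wmin; have /negbT/negP[] := H w.
by rewrite wS rw; apply/forall_inP => u uS; apply: wmin; rewrite inE.
Qed.

Definition crossed y P r : bool := [exists (K | K \in P), lo y K <= r < hi y K].

(** A gap is indexed by a set [K] whose maximum is its lower end, so there are at most [#|P|] of
    them. It counts as 0 when some member of [P] passes over that point. *)
Definition gap y P S K : R :=
  if crossed y P (hi y K) then 0 else next_value y S (hi y K) - hi y K.

Lemma gap_ge0 y P S K : 0 <= gap y P S K.
Proof. by rewrite /gap; case: ifP => // _; rewrite subr_ge0 next_ge. Qed.

(** * Covering an interval of values by diameters and gaps *)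

Section Family.
Variables (y : V -> R) (P : {set {set V}}) (S : {set V}).
Hypothesis P0 : forall K, K \in P -> K != set0.
Hypothesis PS : forall K, K \in P -> K \subset S.
Hypothesis PC : forall i, i \in S -> exists2 K, K \in P & i \in K.

(** The share of [K] in covering from [r] to [b]; truncating its range at [r] lets the covering
    advance one value at a time. *)
Let term r b K : R := Num.max 0 (hi y K - Num.max (lo y K) r) +
  (if r <= hi y K < b then gap y P S K else 0).

Let term_ge0 r b K : 0 <= term r b K.
Proof.
rewrite addr_ge0 ?le_max ?lexx //; case: ifP => // _; exact: gap_ge0.
Qed.

Let term_anti r r' b K : r <= r' -> term r' b K <= term r b K.
Proof.
move=> rr'; apply: lerD.
  rewrite ge_max !le_max lexx /= lerB ?orbT //.
  by rewrite ge_max !le_max lexx rr' orbT.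
case: ifP => [/andP[H1 ->]|_]; first by rewrite (le_trans rr' H1).
by case: ifP => // _; apply: gap_ge0.
Qed.

(** Walk upwards from [y i] to the next value [y v], by induction on the number of vertices above.
    Each step is paid for by a single [K]. *)
Lemma covering_term i j : i \in S -> j \in S ->
  y j - y i <= \sum_(K in P) term (y i) (y j) K.
Proof.
move=> iS jS; have [n] := ubnP #|[set v in S | (y i < y v)%R]|.
elim: n i iS => // n IH i iS cn.
have [ji|ij] := leP (y j) (y i).
  apply: (@le_trans _ _ 0); first by rewrite subr_le0.
  by apply: sumr_ge0 => K _; apply: term_ge0.
have [v [vS iv nv vmin]] := nextP jS ij.
have {IH}IHv : y j - y v <= \sum_(K in P) term (y v) (y j) K.
  apply: IH => //; rewrite -ltnS; apply: leq_trans cn.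
  rewrite ltnS; apply: proper_card; apply/properP; split.
    apply/subsetP => w; rewrite !inE => /andP[-> H] /=; exact: lt_trans H.
  by exists v; rewrite !inE vS ?iv // ltxx.
suff [K KP HK] : exists2 K, K \in P &
    term (y v) (y j) K + (y v - y i) <= term (y i) (y j) K.
  rewrite (bigD1 K) //=.
  have : \sum_(i0 in P | i0 != K) term (y v) (y j) i0 <=
      \sum_(i0 in P | i0 != K) term (y i) (y j) i0.
    by apply: ler_sum => K' _; apply: term_anti; apply: ltW.
  by move: IHv; rewrite (bigD1 K) //=; lra.
(* If [K] straddles [y i], then its maximum is at least [y v], so its range pays for the step. *)
case: (boolP (crossed y P (y i))) => [/exists_inP[K KP /andP[loK hiK]]|/exists_inPn H].
  exists K => //; rewrite /term.
  have vhi : y v <= hi y K.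
    have [w [wK E _]] := hiP y (P0 KP).
    by rewrite E; apply: vmin; rewrite -?E //; apply: (subsetP (PS KP)).
  rewrite (max_r loK) (max_r (le_trans loK (ltW iv))) (ltW hiK) vhi /=.
  by rewrite !max_r ?subr_ge0 ?(ltW hiK) //; lra.
(* Nothing straddles [y i], so the member containing [i] peaks there and the step is exactly its
   gap. *)
have [K KP iK] := PC iS; exists K => //.
have hiK : hi y K = y i.
  have := H _ KP; rewrite (ge_lo y iK) /= -leNgt => hi_le.
  by apply/eqP; rewrite eq_le hi_le (le_hi y iK).
have vi : (y v <= y i) = false by rewrite leNgt iv.
rewrite /term hiK vi /= lexx ij /=.
have -> : gap y P S K = y v - y i.
  rewrite /gap hiK nv; case: ifP => // /exists_inP[K' KP' H'].
  by have /negP[] := H _ KP'.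
rewrite (max_l (_ : _ - _ <= 0)); last first.
  by rewrite subr_le0 le_max (ltW iv) orbT.
by rewrite addr0 add0r lerDr le_max lexx.
Qed.

Definition below K : {set V} := [set v in S | y v <= hi y K].
Definition separates K i j : bool := (i \in below K) (+) (j \in below K).

(** A gap used in the walk starts between the two values, hence its cut separates [i] from [j]. *)
Lemma covering i j : i \in S -> j \in S ->
  `|y i - y j| <= \sum_(K in P) diam y K + \sum_(K in P) gap y P S K * (separates K i j)%:R.
Proof.
wlog ij : i j / y i <= y j.
  move=> W iS jS; case: (leP (y i) (y j)) => [ij|/ltW ji]; first exact: W.
  rewrite distrC; apply: le_trans (W _ _ ji jS iS) _; rewrite lerD2l.
  by apply: ler_sum => K _; rewrite /separates addbC.
move=> iS jS; rewrite distrC ger0_norm ?subr_ge0 //.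
apply: le_trans (covering_term iS jS) _.
rewrite -big_split /=; apply: ler_sum => K KP; apply: lerD.
  by rewrite ge_max diam_ge0 ?P0 //= lerB // le_max lexx.
case: ifP => [/andP[ik kj]|_]; last by rewrite mulr_ge0 ?gap_ge0 ?ler0n.
by rewrite /separates !inE iS jS ik [y j <= _]leNgt kj mulr1.
Qed.

Lemma gap_below K v w : 0 < gap y P S K -> v \in below K -> w \in S :\: below K ->
  y v <= hi y K /\ hi y K + gap y P S K <= y w.
Proof.
rewrite /gap; case: ifP => [_|_ g0]; first by rewrite ltxx.
rewrite !inE => /andP[vS vK] /andP[+ wS]; rewrite wS /= -ltNge => wK.
split=> //; rewrite addrC subrK.
by have [u [_ _ -> ->]] := nextP wS wK.
Qed.

Lemma below_nonempty K : K \in P -> below K != set0.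
Proof.
move=> KP; have /set0Pn[i iK] := P0 KP; apply/set0Pn; exists i.
by rewrite inE (subsetP (PS KP)) // le_hi.
Qed.

Lemma above_nonempty K : 0 < gap y P S K -> S :\: below K != set0.
Proof.
rewrite /gap; case: ifP => [_|_]; first by rewrite ltxx.
rewrite /next_value; case: pickP => [v /and3P[vS lt_v _] _|_]; last by rewrite subrr ltxx.
by apply/set0Pn; exists v; rewrite !inE vS leNgt lt_v.
Qed.

Lemma sum_separates K :
  \sum_(i in S) \sum_(j in S) (separates K i j)%:R =
  2 * (#|below K|%:R * #|S :\: below K|%:R) :> R.
Proof.
have bS : below K \subset S by apply/subsetP => v; rewrite inE => /andP[].
have sumB (A : {set V}) (b : bool) : A \subset S -> (forall i, i \in A -> (i \in below K) = b) ->
    \sum_(i in A) \sum_(j in S) (separates K i j)%:R =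
    #|A|%:R * (if b then #|S :\: below K|%:R else #|below K|%:R) :> R.
  move=> AS AB; rewrite mulr_natl -sumr_const; apply: eq_bigr => i /AB iB.
  rewrite -natr_sum (big_setID (below K)) /= (setIidPr bS); case: b {AB} iB => iB.
    rewrite big1 => [|j jB]; last by rewrite /separates iB jB.
    rewrite add0n -sum1_card; congr _%:R; apply: eq_bigr => j.
    by rewrite /separates iB inE => /andP[/negbTE ->].
  rewrite [X in (_ + X)%N]big1 => [|j]; last first.
    by rewrite /separates iB inE => /andP[/negbTE ->].
  rewrite addn0 -sum1_card; congr _%:R; apply: eq_bigr => j jB.
  by rewrite /separates iB jB.
rewrite (big_setID (below K)) /= (setIidPr bS) (sumB _ true bS) //.
rewrite (sumB _ false) ?subsetDl //; last by move=> i; rewrite inE => /andP[/negbTE].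
ring.
Qed.
End Family.

(** Cauchy-Schwarz, read off from [sqdev_ge0]. *)
Lemma sqr_sum_le (I : finType) (A : {set I}) (f : I -> R) :
  (\sum_(i in A) f i) ^+ 2 <= #|A|%:R * \sum_(i in A) f i ^+ 2.
Proof.
have := ler_wpM2l (ler0n R #|A|) (sqdev_ge0 f A).
rewrite mulr0 sqdevE mulrBr subr_ge0 (sum_avg f A).
by have -> : (#|A|%:R * avg f A) ^+ 2 = #|A|%:R * (#|A|%:R * avg f A ^+ 2) by ring.
Qed.

(** * Gaps between the components of a graph *)

Section Graph.
Variables (e : rel V) (y : V -> R) (S : {set V}).
Hypothesis e_sym : symmetric e.
Hypothesis st : stable e S.
Let P := comps_in e S.

Lemma comps_in_family :
  [/\ forall K, K \in P -> K != set0, forall K, K \in P -> K \subset S &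
      forall i, i \in S -> exists2 K, K \in P & i \in K].
Proof.
split=> [K /(comps_inP _ st)[i _ ->]|K|i iS].
- by apply/set0Pn; exists i; apply: mem_comp.
- by rewrite inE => /andP[].
- by exists (conn_comp e i); rewrite ?mem_comp //; apply/comps_inP => //; exists i.
Qed.

Let P0 : forall K, K \in P -> K != set0. Proof. by case: comps_in_family. Qed.
Let PS : forall K, K \in P -> K \subset S. Proof. by case: comps_in_family. Qed.
Let PC : forall i, i \in S -> exists2 K, K \in P & i \in K.
Proof. by case: comps_in_family. Qed.

(** The component of an edge across the cut would straddle [hi y K], forcing the gap to be 0. *)
Lemma stable_below K : 0 < gap y P S K -> stable e (below y S K).
Proof.
move=> g0; suff H i j : e i j -> i \in below y S K -> j \in below y S K.
  by move=> i j ij; apply/idP/idP; apply: H; rewrite // e_sym.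
move=> ij; rewrite !inE -(st ij) => /andP[iS iK]; rewrite iS /= leNgt.
apply/negP => jK; move: g0; rewrite /gap; case: ifP => [_|/negbT/negP[]]; first by rewrite ltxx.
apply/exists_inP; exists (conn_comp e i); first by apply/comps_inP => //; exists i.
rewrite (le_trans (ge_lo y (mem_comp e i)) iK) (lt_le_trans jK) // le_hi //.
by rewrite inE connect1.
Qed.

(** Square [covering] for every pair, using [(D + b)^2 <= 2 D^2 + 2 b^2] and Cauchy-Schwarz over at
    most [k] components, then sum over all pairs of [S]. *)
Lemma sqdev_covering (k : nat) : (#|P| <= k)%N ->
  #|S|%:R * sqdev y S <= 2 * k%:R * #|S|%:R ^+ 2 * (\sum_(K in P) sqdev y K) +
    2 * k%:R * \sum_(K in P) gap y P S K ^+ 2 *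
       (#|below y S K|%:R * #|S :\: below y S K|%:R).
Proof.
move=> Pk; have Pk' : #|P|%:R <= k%:R :> R by rewrite ler_nat.
set Q := \sum_(K in P) sqdev y K.
set D := \sum_(K in P) diam y K.
have D0 : 0 <= D by apply: sumr_ge0 => K /P0; apply: diam_ge0.
have HD : D ^+ 2 <= 2 * k%:R * Q.
  apply: le_trans (sqr_sum_le _ _) _; rewrite -mulrA mulrCA.
  apply: ler_pM => //; first by apply: sumr_ge0 => K _; apply: sqr_ge0.
  by rewrite /Q mulr_sumr; apply: ler_sum => K /P0; apply: diam_sqdev.
have pair i j : i \in S -> j \in S -> (y i - y j) ^+ 2 <= 4 * k%:R * Q +
    2 * k%:R * \sum_(K in P) gap y P S K ^+ 2 * (separates y S K i j)%:R.
  move=> iS jS; set b := \sum_(K in P) gap y P S K * (separates y S K i j)%:R.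
  have b0 : 0 <= b by apply: sumr_ge0 => K _; rewrite mulr_ge0 ?gap_ge0 ?ler0n.
  have Hb : b ^+ 2 <= k%:R * \sum_(K in P) gap y P S K ^+ 2 * (separates y S K i j)%:R.
    apply: le_trans (sqr_sum_le _ _) _.
    have -> : \sum_(K in P) (gap y P S K * (separates y S K i j)%:R) ^+ 2 =
        \sum_(K in P) gap y P S K ^+ 2 * (separates y S K i j)%:R.
      by apply: eq_bigr => K _; case: separates; rewrite ?mulr1 // !mulr0 expr0n.
    apply: ler_wpM2r => //.
    by apply: sumr_ge0 => K _; rewrite mulr_ge0 ?sqr_ge0 ?ler0n.
  have : (y i - y j) ^+ 2 <= (D + b) ^+ 2.
    rewrite -real_normK ?num_real // ler_sqr ?nnegrE ?addr_ge0 //.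
    exact: (covering y P0 PS PC).
  have := sqr_ge0 (D - b); rewrite sqrrD sqrrB -mulr_natl; lra.
have : \sum_(i in S) \sum_(j in S) (y i - y j) ^+ 2 <=
   \sum_(i in S) \sum_(j in S) (4 * k%:R * Q +
    2 * k%:R * \sum_(K in P) gap y P S K ^+ 2 * (separates y S K i j)%:R).
  by apply: ler_sum => i iS; apply: ler_sum => j jS; apply: pair.
rewrite sum_pairs_sqdev.
under [leRHS]eq_bigr do rewrite big_split /= sumr_const -mulr_sumr.
rewrite big_split /= sumr_const -mulr_sumr.
have -> : \sum_(i in S) \sum_(j in S) \sum_(K in P) gap y P S K ^+ 2 * (separates y S K i j)%:R
   = 2 * \sum_(K in P) gap y P S K ^+ 2 * (#|below y S K|%:R * #|S :\: below y S K|%:R).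
  under eq_bigr do rewrite exchange_big /=.
  rewrite exchange_big /= mulr_sumr; apply: eq_bigr => K _.
  under eq_bigr do rewrite -mulr_sumr.
  by rewrite -mulr_sumr sum_separates; ring.
rewrite -(mulr_natr (4 * _ * _)) -(mulr_natr (4 * _ * _ * _)).
set T := \sum_(K in P) _; set N := #|S|%:R; set v := sqdev y S.
by move=> H; rewrite -(ler_pM2l (ltr0n R 2)); apply: le_trans (le_trans _ H) _;
   rewrite le_eqVlt; apply/orP; left; apply/eqP; ring.
Qed.

(** If the first alternative fails, the component part of [sqdev_covering] is less than half of its
    left side. The gap part then exceeds the other half, and the largest of its at most [k] terms
    gives the cut. *)
Lemma mix_or_split (k : nat) : (#|P| <= k)%N -> S != set0 -> 0 < sqdev y S ->
  sqdev y S <= 4 * k%:R * #|S|%:R * (\sum_(K in P) sqdev y K) \/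
  exists L a b, [/\ L \subset S, L != set0, S :\: L != set0, stable e L & a < b] /\
    [/\ forall v, v \in L -> y v <= a, forall w, w \in S :\: L -> b <= y w &
     #|S|%:R * sqdev y S <=
       4 * k%:R ^+ 2 * (b - a) ^+ 2 * (#|L|%:R * #|S :\: L|%:R)].
Proof.
move=> Pk S0 V0; have N0 : 0 < #|S|%:R :> R by rewrite ltr0n card_gt0.
have P1 : (0 < #|P|)%N.
  by have /set0Pn[i iS] := S0; apply: comps_in_gt0 iS.
have k0 : 0 < k%:R :> R by rewrite ltr0n (leq_trans P1).
case: leP => [|mix]; [by left|right].
pose w K : R := gap y P S K ^+ 2 * (#|below y S K|%:R * #|S :\: below y S K|%:R).
have [K KP HK] : exists2 K, K \in P & #|S|%:R * sqdev y S <= 4 * k%:R ^+ 2 * w K.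
  case: (boolP [exists (K | K \in P), #|S|%:R * sqdev y S <= 4 * k%:R ^+ 2 * w K]).
    by move=> /exists_inP[K]; exists K.
  move=> /exists_inPn H; exfalso.
  have : \sum_(K in P) 4 * k%:R ^+ 2 * w K <= \sum_(K in P) #|S|%:R * sqdev y S.
    by apply: ler_sum => K /H; rewrite -ltNge => /ltW.
  rewrite sumr_const -(mulr_natl (_ * sqdev y S)) -mulr_sumr => H1.
  have {H1}H1 : 4 * k%:R ^+ 2 * \sum_(K in P) w K <= k%:R * (#|S|%:R * sqdev y S).
    apply: le_trans H1 _; apply: ler_wpM2r; last by rewrite ler_nat.
    by rewrite mulr_ge0 ?sqdev_ge0.
  have {H1}H1 : 4 * k%:R * \sum_(K in P) w K <= #|S|%:R * sqdev y S.
    rewrite -(ler_pM2l k0); apply: le_trans H1.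
    by rewrite le_eqVlt; apply/orP; left; apply/eqP; ring.
  have H2 := sqdev_covering Pk.
  have H3 : #|S|%:R * (4 * k%:R * #|S|%:R * \sum_(K in P) sqdev y K) < #|S|%:R * sqdev y S.
    by rewrite ltr_pM2l.
  move: H1 H2 H3; rewrite -/(w _); set T := \sum_(K in P) w K.
  set Q := \sum_(K in P) sqdev y K; set N := #|S|%:R; set v := sqdev y S.
  have -> : N * (4 * k%:R * N * Q) = 2 * (2 * k%:R * N ^+ 2 * Q) by ring.
  have -> : 4 * k%:R * T = 2 * (2 * k%:R * T) by ring.
  lra.
have g0 : 0 < gap y P S K.
  rewrite lt_def gap_ge0 andbT; apply/eqP => g0.
  by move: HK; rewrite /w g0 expr0n /= mul0r mulr0 leNgt mulr_gt0.
exists (below y S K), (hi y K), (hi y K + gap y P S K); split; split.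
- by apply/subsetP => v; rewrite inE => /andP[].
- exact: (below_nonempty _ P0 PS).
- exact: above_nonempty g0.
- exact: stable_below.
- by rewrite ltrDl.
- by move=> v; rewrite inE => /andP[].
- move=> v vK; have /set0Pn[u uK] := below_nonempty y P0 PS KP.
  by have [_] := gap_below g0 uK vK.
- by rewrite addrC addKr -mulrA.
Qed.

End Graph.
End Covering.

(** * Energy of systems confined to a vertex set *)

(** With [u = s * theta <= 1]: [(1 - theta)^s <= exp (- u) <= 1 / (1 + u) <= 1 - u / 2]. *)
Lemma powR_drop (R : realType) (v w theta s : R) : 0 < s <= 1 -> 0 <= theta <= 1 ->
  0 <= w -> w <= (1 - theta) * v -> w `^ s <= v `^ s * (1 - s * theta / 2).
Proof.
move=> /andP[s0 s1] /andP[t0 t1] w0 wv.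
have [v0|v0] := leP v 0.
  have -> : w = 0 by apply/eqP; rewrite eq_le w0 andbT; nra.
  rewrite powR0 ?gt_eqF //; apply: mulr_ge0; first exact: powR_ge0.
  by nra.
have v00 := ltW v0.
apply: (@le_trans _ _ (((1 - theta) * v) `^ s)).
  by apply: ge0_ler_powR; rewrite ?nnegrE ?(ltW s0) // mulr_ge0 // subr_ge0.
rewrite powRM // ?subr_ge0 // mulrC; apply: ler_wpM2l; first exact: powR_ge0.
apply: (@le_trans _ _ (expR (- theta) `^ s)).
  apply: ge0_ler_powR; rewrite ?nnegrE ?(ltW s0) ?subr_ge0 ?expR_ge0 //.
  exact: expR_ge1Dx.
rewrite -expRM mulNr expRN -[leRHS]invrK.
have st0 : 0 <= theta * s by rewrite mulr_ge0 // ltW.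
have st1 : theta * s <= 1 by rewrite mulr_ile1 // ltW.
have p : 0 < 1 - s * theta / 2 by lra.
rewrite lef_pV2 ?posrE ?expR_gt0 ?invr_gt0 //.
apply: (@le_trans _ _ (1 + theta * s)); last exact: expR_ge1Dx.
by rewrite -[leLHS]mul1r ler_pdivrMr //; nra.
Qed.

Lemma weighted_binomial (j a b : nat) : (j.+1 * (a ^ j * b) <= (a + b) ^ j.+1)%N.
Proof.
(* Keeping two terms of the binomial expansion makes the induction go through. *)
suff : (j.+1 * (a ^ j * b) + a ^ j.+1 <= (a + b) ^ j.+1)%N by apply: leq_trans; apply: leq_addr.
elim: j => [|j IH]; first by rewrite !expn1 expn0; lia.
rewrite [((a + b) ^ _)%N]expnS; apply: leq_trans (leq_mul (leqnn _) IH).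
by rewrite !expnS; nia.
Qed.

(* The induction hypothesis for the two sides costs [nl ^ j + nr ^ j]; when the cut is
   unbalanced the drop is large, when it is balanced this cost is small, and
   [weighted_binomial] says that the two effects compensate. *)
Lemma split_budget (R : realType) (A s B : R) (M j nl nr : nat) :
  1 <= A -> 0 < s <= 1 -> B = 32 * A * M%:R / s -> (0 < j)%N -> (j < M)%N ->
  (0 < nl)%N -> (0 < nr)%N -> (j < nl + nr)%N ->
  (B * nl%:R) ^+ j + (B * nr%:R) ^+ j + j.+1%:R <=
  (B * (nl + nr)%:R) ^+ j.+1 * (s / 2) *
    ((nl + nr)%:R / (8 * A * j.+1%:R ^+ 2 * (nl%:R * nr%:R))).
Proof.
move=> A1 /andP[s0 s1] EB j0 jM l0 r0 jN; set N := (nl + nr)%N; set k := j.+1.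
have L0 : 0 < nl%:R :> R by rewrite ltr0n.
have R0 : 0 < nr%:R :> R by rewrite ltr0n.
have K0 : 0 < k%:R :> R by rewrite ltr0n.
have N0 : 0 < N%:R :> R by rewrite ltr0n /N; lia.
have A0 : 0 < A by lra.
have kM : k%:R <= M%:R :> R by rewrite ler_nat.
have M0 : 0 < M%:R :> R by lra.
have kN : k%:R <= N%:R :> R by rewrite ler_nat.
have B0 : 0 < B by rewrite EB divr_gt0 ?mulr_gt0.
have Bk : k%:R <= B.
  rewrite EB ler_pdivlMr //; apply: le_trans (_ : _ <= 1 * M%:R) _; first by nra.
  by apply: ler_wpM2r; [exact: ltW|lra].
set p : R := nl%:R * nr%:R; have p0 : 0 < p by rewrite mulr_gt0.
(* The right side is at least [2 * W]: one [W] pays for the two sides, the other for the summand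
   [j.+1]. *)
set W := B ^+ j * N%:R ^+ k.+1 / (k%:R * p).
have W2 : 2 * W <= (B * N%:R) ^+ k * (s / 2) * (N%:R / (8 * A * k%:R ^+ 2 * p)).
  have -> : (B * N%:R) ^+ k * (s / 2) * (N%:R / (8 * A * k%:R ^+ 2 * p)) =
      W * (B * s / (16 * A * k%:R)).
    by rewrite /W exprMn (exprS B) (exprS _ k); field; rewrite !gt_eqF.
  rewrite mulrC; apply: ler_wpM2l.
    by apply: divr_ge0; [apply: mulr_ge0; apply: exprn_ge0|apply: mulr_ge0]; apply: ltW.
  (* The factor 32 in [B] is chosen to produce this 2. *)
  have -> : B * s / (16 * A * k%:R) = 2 * (M%:R / k%:R).
    by rewrite EB; field; rewrite !gt_eqF.
  by rewrite ler_peMr // ler_pdivlMr // mul1r.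
apply: le_trans W2; rewrite mulr2n mulrDl mul1r; apply: lerD.
  have wb (a b : nat) : (a + b)%N = N -> k%:R * (a%:R ^+ j * b%:R) <= N%:R ^+ k :> R.
    by move=> <-; rewrite -!natrX -!natrM ler_nat; apply: weighted_binomial.
  rewrite /W ler_pdivlMr ?mulr_gt0 // !exprMn -mulrDr -mulrA.
  apply: ler_wpM2l; first by rewrite exprn_ge0 // ltW.
  have H1 := wb nl nr erefl; have H2 := wb nr nl (addnC _ _).
  have -> : N%:R ^+ k.+1 = N%:R ^+ k * nl%:R + N%:R ^+ k * nr%:R :> R.
    by rewrite exprSr -mulrDr -natrD.
  rewrite /p.
  have -> : (nl%:R ^+ j + nr%:R ^+ j) * (k%:R * (nl%:R * nr%:R)) =
      k%:R * (nl%:R ^+ j * nr%:R) * nl%:R + k%:R * (nr%:R ^+ j * nl%:R) * nr%:R :> R by ring.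
  exact: lerD (ler_wpM2r (ltW L0) H1) (ler_wpM2r (ltW R0) H2).
have pN : p <= N%:R ^+ 2.
  by rewrite /p expr2 /N natrD; nra.
have BNj : k%:R ^+ 2 <= B ^+ j * N%:R ^+ j.
  rewrite -exprMn; apply: (@le_trans _ _ (B * N%:R)).
    by rewrite expr2; apply: ler_pM => //; apply: ltW.
  apply: ler_eXnr => //; apply: mulr_ege1.
    by apply: le_trans Bk; rewrite ler1n.
  by apply: le_trans kN; rewrite ler1n.
rewrite /W ler_pdivlMr ?mulr_gt0 //.
have -> : k%:R * (k%:R * p) = k%:R ^+ 2 * p by ring.
have -> : B ^+ j * N%:R ^+ k.+1 = B ^+ j * N%:R ^+ j * N%:R ^+ 2.
  by rewrite (exprS _ k) (exprS _ j); ring.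
by apply: ler_pM => //; rewrite ?sqr_ge0 // ltW.
Qed.

Lemma comps_in1 (V : finType) (e : rel V) (S : {set V}) : symmetric e -> stable e S ->
  S != set0 -> (#|comps_in e S| <= 1)%N -> comps_in e S = [set S].
Proof.
move=> e_sym st /set0Pn[i iS] c1.
have iP : conn_comp e i \in comps_in e S by apply/comps_inP => //; exists i.
have [K EK] : exists K, comps_in e S = [set K].
  by apply/cards1P; rewrite eqn_leq c1; apply/card_gt0P; exists (conn_comp e i).
suff EKS : K = S by rewrite EK EKS.
move: iP; rewrite EK inE => /eqP iK; apply/eqP; rewrite eqEsubset.
apply/andP; split; first by rewrite -iK comp_subset.
apply/subsetP => j jS.
have : conn_comp e j \in comps_in e S by apply/comps_inP => //; exists j.
by rewrite EK inE => /eqP <-; apply: mem_comp.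
Qed.

Lemma first_failure (Q : nat -> Prop) (t0 t1 : nat) :
  (forall t, (t0 <= t < t1)%N -> Q t) \/
  exists t, [/\ (t0 <= t < t1)%N, forall u, (t0 <= u < t)%N -> Q u & ~ Q t].
Proof.
elim: t1 => [|t1 [IH|[t [tr H1 H2]]]]; first by left=> t; rewrite ltn0 andbF.
- have [le01|lt10] := leqP t0 t1; last by left=> t tr; apply: IH; lia.
  have [q|nq] := pselect (Q t1); last by right; exists t1; split=> //; lia.
  by left=> t tr; have [->//|tt1] := eqVneq t t1; apply: IH; lia.
- by right; exists t; split=> //; lia.
Qed.

(** * Energy recursion for systems that dissipate deviations and shrink convex hulls *)

Section Energy.
Variables (R : realType) (V : finType) (e : nat -> rel V) (x : nat -> V -> R) (A s : R).
Implicit Types (S K L X : {set V}) (t u k : nat).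
Hypothesis e_sym : forall t, symmetric (e t).
Hypothesis A1 : 1 <= A.
Hypothesis s01 : 0 < s <= 1.
Hypothesis mixing : forall t S, stable (e t) S -> sqdev (x t.+1) S <=
  sqdev (x t) S - (\sum_(K in comps_in (e t) S) sqdev (x t) K) / A.
Hypothesis hull_le : forall t S c, stable (e t) S ->
  (forall i, i \in S -> x t i <= c) -> forall i, i \in S -> x t.+1 i <= c.
Hypothesis hull_ge : forall t S c, stable (e t) S ->
  (forall i, i \in S -> c <= x t i) -> forall i, i \in S -> c <= x t.+1 i.

(** Since [sqdev] scales like a squared length, [s] here stands for half of the exponent put on
    block lengths. *)
Definition energy t S : R := \sum_(K in comps_in (e t) S) sqdev (x t) K `^ s.
Definition confined k t0 t1 S := forall t, (t0 <= t < t1)%N ->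
  stable (e t) S /\ (#|comps_in (e t) S| <= k)%N.

Let A0 : 0 < A. Proof. by apply: lt_le_trans A1. Qed.
Let s0 : 0 < s. Proof. by case/andP: s01. Qed.
Let s1 : s <= 1. Proof. by case/andP: s01. Qed.

Lemma le_powR (v w : R) : 0 <= v -> v <= w -> v `^ s <= w `^ s.
Proof.
move=> v0 vw; apply: ge0_ler_powR; rewrite ?nnegrE ?(ltW s0) //.
exact: le_trans vw.
Qed.

Lemma energy_le k t S : stable (e t) S -> (#|comps_in (e t) S| <= k)%N ->
  energy t S <= k%:R * sqdev (x t) S `^ s.
Proof.
move=> st ck; apply: (@le_trans _ _ (\sum_(K in comps_in (e t) S) sqdev (x t) S `^ s)).
  apply: ler_sum => K; rewrite inE => /andP[_ KS].
  by apply: le_powR; [exact: sqdev_ge0|exact: sqdevS].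
rewrite sumr_const -[leLHS]mulr_natl; apply: ler_wpM2r; first exact: powR_ge0.
by rewrite ler_nat.
Qed.

Lemma sqdev_step t S : stable (e t) S -> sqdev (x t.+1) S <= sqdev (x t) S.
Proof.
move=> /mixing /le_trans; apply; rewrite gerBl divr_ge0 ?(ltW A0) //.
by apply: sumr_ge0 => K _; apply: sqdev_ge0.
Qed.

Lemma sqdev_anti t0 t S : (t0 <= t)%N -> (forall u, (t0 <= u < t)%N -> stable (e u) S) ->
  sqdev (x t) S <= sqdev (x t0) S.
Proof.
elim: t => [|t IH]; first by rewrite leqn0 => /eqP ->.
rewrite leq_eqVlt => /predU1P[->//|t0t] H.
apply: le_trans (sqdev_step (H t _)) (IH _ _) => [||u ur]; [lia|lia|].
by apply: H; lia.
Qed.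

Lemma hull_window t0 t S a b : (t0 <= t)%N ->
    (forall u, (t0 <= u < t)%N -> stable (e u) S) ->
  (forall i, i \in S -> a <= x t0 i <= b) -> forall i, i \in S -> a <= x t i <= b.
Proof.
elim: t => [|t IH]; first by rewrite leqn0 => /eqP ->.
rewrite leq_eqVlt => /predU1P[->//|t0t] H H0 i iS.
have {}IH := IH t0t (fun u ur => H u (ltac:(lia))) H0.
have st : stable (e t) S by apply: H; lia.
apply/andP; split; [apply: (hull_ge st)|apply: (hull_le st)] => //.
  by move=> j /IH/andP[].
by move=> j /IH/andP[].
Qed.

Lemma confinedW k t0 t1 u0 u1 S : (t0 <= u0)%N -> (u1 <= t1)%N ->
  confined k t0 t1 S -> confined k u0 u1 S.
Proof. by move=> l0 l1 H t tr; apply: H; lia. Qed.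

(** A single component contracts by [1 - 1 / A] at each step, so the energies are dominated by a
    geometric series of ratio [1 - s / (2 A)]. *)
Lemma energy_one t0 t1 S : S != set0 -> confined 1 t0 t1 S ->
  \sum_(t0 <= t < t1) energy t S <= 2 * A / s * sqdev (x t0) S `^ s.
Proof.
move=> S0; have [n] := ubnP (t1 - t0); elim: n t0 => // n IH t0 tn H.
have C0 : 0 <= 2 * A / s by rewrite divr_ge0 ?mulr_ge0 ?(ltW A0) ?(ltW s0).
have [le10|lt01] := leqP t1 t0.
  by rewrite big_geq // mulr_ge0 ?powR_ge0.
rewrite big_ltn //; have [st c1] : stable (e t0) S /\ (#|comps_in (e t0) S| <= 1)%N.
  by apply: H; rewrite leqnn.
have {}IH := IH t0.+1 ltac:(lia) (confinedW (leqnSn _) (leqnn _) H).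
have E1 := comps_in1 (@e_sym t0) st S0 c1.
rewrite {1}/energy E1 big_set1.
have := mixing st; rewrite E1 big_set1 => drop.
have th : 0 <= A^-1 <= 1 by rewrite invr_ge0 (ltW A0) invf_le1 // A1.
have := powR_drop s01 th (sqdev_ge0 (x t0.+1) S).
move=> /(_ (sqdev (x t0) S)) Hd.
have {Hd}Hd : sqdev (x t0.+1) S `^ s <= sqdev (x t0) S `^ s * (1 - s * A^-1 / 2).
  by apply: Hd; move: drop; rewrite mulrBl mul1r mulrC.
apply: le_trans (lerD (lexx _) (le_trans IH (ler_wpM2l C0 Hd))) _.
rewrite le_eqVlt; apply/orP; left; apply/eqP; field.
by rewrite !gt_eqF.
Qed.

Lemma crossing t S L i j : L \subset S -> stable (e t) S ->
    e t i j -> i \in L -> j \notin L -> exists2 K, K \in comps_in (e t) S &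
  [/\ i \in K, j \in K & j \in S :\: L].
Proof.
move=> LS st ij iL jL; have iS := subsetP LS _ iL.
exists (conn_comp (e t) i); first by apply/comps_inP => //; exists i.
by rewrite mem_comp !inE jL connect1 // -(st _ _ ij).
Qed.

(** An edge leaving [L] puts two values at distance at least [b - a] into one component, and
    [sqdev_diam] applies there. *)
Lemma crossing_mixing t S L a b : a < b -> L \subset S -> stable (e t) S ->
    ~ stable (e t) L -> (forall v, v \in L -> x t v <= a) ->
    (forall w, w \in S :\: L -> b <= x t w) ->
  (b - a) ^+ 2 <= 2 * \sum_(K in comps_in (e t) S) sqdev (x t) K.
Proof.
move=> ab LS st nst HL HR.
have [i [j [ij iL jL]]] : exists i j, [/\ e t i j, i \in L & j \notin L].
  apply: contrapT => H; apply: nst => i j ij; apply/idP/idP => [iL|jL].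
    by case: (boolP (j \in L)) => // jL; exfalso; apply: H; exists i, j.
  case: (boolP (i \in L)) => // iL; exfalso; apply: H.
  by exists j, i; rewrite e_sym.
have [K KP [iK jK jR]] := crossing LS st ij iL jL.
apply: (@le_trans _ _ ((x t j - x t i) ^+ 2)).
  by have := HL _ iL; have := HR _ jR; rewrite !expr2; nra.
apply: le_trans (sqdev_diam (x t) jK iK) _; rewrite ler_pM2l //.
rewrite (bigD1 K) //= lerDl; apply: sumr_ge0 => K' _; exact: sqdev_ge0.
Qed.

(** Accounting shared by the mixing and splitting cases. The times before [t] cost [cost] and time
    [t] costs at most [k]; the relative drop [theta] at [t] saves [F * (s / 2) * theta] on the bound
    for later times, which pays for both. *)
Lemma energy_tail k t0 t t1 S (F theta cost : R) : (t0 <= t < t1)%N ->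
    confined k t0 t1 S -> 0 < sqdev (x t0) S -> 0 <= F -> 0 <= theta ->
    theta * sqdev (x t0) S <= (\sum_(K in comps_in (e t) S) sqdev (x t) K) / A ->
    cost + k%:R <= F * (s / 2) * theta ->
    \sum_(t0 <= u < t) energy u S <= cost * sqdev (x t0) S `^ s ->
    \sum_(t.+1 <= u < t1) energy u S <= F * sqdev (x t.+1) S `^ s ->
  \sum_(t0 <= u < t1) energy u S <= F * sqdev (x t0) S `^ s.
Proof.
move=> tr cf V0 F0 th0 drop budget costP tailP.
have [stt ct] := cf t tr.
have Vt : sqdev (x t) S <= sqdev (x t0) S.
  case/andP: tr => tr1 tr2; apply: sqdev_anti => // u /andP[u1 u2].
  by apply: (cf u _).1; rewrite u1 (ltn_trans u2).
have Vt1 : sqdev (x t.+1) S <= (1 - theta) * sqdev (x t0) S.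
  by have := mixing stt; rewrite mulrBl mul1r; lra.
have th1 : theta <= 1.
  by have := le_trans (sqdev_ge0 _ _) Vt1; rewrite pmulr_lge0 // subr_ge0.
have := powR_drop s01 (introT andP (conj th0 th1)) (sqdev_ge0 (x t.+1) S) Vt1.
set v0 := sqdev (x t0) S `^ s in costP *; have v00 : 0 <= v0 by apply: powR_ge0.
move=> /(ler_wpM2l F0) vt1.
have stepP : energy t S <= k%:R * v0.
  apply: le_trans (energy_le stt ct) _; apply: ler_wpM2l; first exact: ler0n.
  by apply: le_powR => //; apply: sqdev_ge0.
have budget' := ler_wpM2r v00 budget.
case/andP: tr => tr1 tr2.
rewrite (big_cat_nat tr1 (ltnW tr2)) /= (big_ltn tr2).
have E : F * (v0 * (1 - s * theta / 2)) = F * v0 - F * (s / 2) * theta * v0 by field.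
by move: vt1 budget'; rewrite E mulrDl; lra.
Qed.

(** While no edge joins the two sides the energy is additive; each side holds at least one
    component, leaving at most [j] for the other. *)
Lemma energy_split j t0 t S L (B : R) : 0 <= B -> L \subset S -> L != set0 ->
    S :\: L != set0 -> confined j.+1 t0 t S ->
    (forall u, (t0 <= u < t)%N -> stable (e u) L) ->
    (forall X, X != set0 -> confined j t0 t X ->
       \sum_(t0 <= u < t) energy u X <= (B * #|X|%:R) ^+ j * sqdev (x t0) X `^ s) ->
  \sum_(t0 <= u < t) energy u S <=
    ((B * #|L|%:R) ^+ j + (B * #|S :\: L|%:R) ^+ j) * sqdev (x t0) S `^ s.
Proof.
move=> B0 LS L0 R0 cf HL IH.
have -> : \sum_(t0 <= u < t) energy u S =
    \sum_(t0 <= u < t) energy u L + \sum_(t0 <= u < t) energy u (S :\: L).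
  rewrite -big_split /= !big_nat; apply: eq_bigr => u ur.
  by apply: sum_comps_inU => //; [exact: (cf u ur).1|exact: HL].
have side X : X \subset S -> X != set0 -> confined j t0 t X ->
    \sum_(t0 <= u < t) energy u X <= (B * #|X|%:R) ^+ j * sqdev (x t0) S `^ s.
  move=> XS X0 cX; apply: le_trans (IH _ X0 cX) _.
  apply: ler_wpM2l; first by rewrite exprn_ge0 // mulr_ge0.
  by apply: le_powR; [exact: sqdev_ge0|exact: sqdevS].
have sides u : (t0 <= u < t)%N -> [/\ stable (e u) L, stable (e u) (S :\: L),
    (#|comps_in (e u) L| <= j)%N & (#|comps_in (e u) (S :\: L)| <= j)%N].
  move=> ur; have [stu cu] := cf u ur; have stLu := HL u ur.
  have stRu := stableD stu stLu; move: cu; rewrite (card_comps_inU stu stLu LS).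
  have /set0Pn[l lL] := L0; have /set0Pn[r rR] := R0.
  have := comps_in_gt0 stLu lL; have := comps_in_gt0 stRu rR.
  by move=> r0 l0 lr; split=> //; move: r0 l0 lr; clear; lia.
rewrite mulrDl; apply: lerD; apply: side; rewrite ?subsetDl //.
  by move=> u /sides[].
by move=> u /sides[].
Qed.

Lemma energy_const k t0 t1 S : sqdev (x t0) S <= 0 -> confined k t0 t1 S ->
  \sum_(t0 <= t < t1) energy t S <= 0.
Proof.
move=> V0 cf; rewrite big_nat; apply: sumr_le0 => t tr; have [st c] := cf t tr.
apply: le_trans (energy_le st c) _.
have -> : sqdev (x t) S = 0.
  apply/eqP; rewrite eq_le sqdev_ge0 andbT; apply: le_trans V0.
  case/andP: tr => tr1 tr2; apply: sqdev_anti => // u /andP[u1 u2].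
  by apply: (cf u _).1; rewrite u1 (ltn_trans u2).
by rewrite powR0 ?mulr0 // gt_eqF.
Qed.

(** Both hulls have only shrunk before [t], so the gap from [a] to [b] is still open when the first
    edge crosses it. [crossing_mixing] then turns the lower bound on the gap into a relative
    drop. *)
Lemma split_mixing t0 t S L a b (k : nat) :
    [/\ L \subset S, L != set0, S :\: L != set0, a < b & (0 < k)%N] ->
    (t0 <= t)%N -> (forall u, (t0 <= u <= t)%N -> stable (e u) S) ->
    (forall u, (t0 <= u < t)%N -> stable (e u) L) -> ~ stable (e t) L ->
    (forall v, v \in L -> x t0 v <= a) -> (forall w, w \in S :\: L -> b <= x t0 w) ->
    #|S|%:R * sqdev (x t0) S <= 4 * k%:R ^+ 2 * (b - a) ^+ 2 * (#|L|%:R * #|S :\: L|%:R) ->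
  #|S|%:R / (8 * A * k%:R ^+ 2 * (#|L|%:R * #|S :\: L|%:R)) * sqdev (x t0) S <=
    (\sum_(K in comps_in (e t) S) sqdev (x t) K) / A.
Proof.
move=> [LS L0 R0 ab k0] t0t stS stays leaves La Rb gapP.
have HL v : v \in L -> x t v <= a.
  move=> vL; have := @hull_window t0 t L (lo (x t0) L) a t0t stays.
  case/(_ _ v vL)/andP => // i iL; rewrite La // andbT; exact: ge_lo.
have HR w : w \in S :\: L -> b <= x t w.
  move=> wR; have := @hull_window t0 t (S :\: L) b (hi (x t0) (S :\: L)) t0t.
  case/(_ _ _ w wR)/andP => // [u /andP[u1 u2]|i iR].
    by apply: stableD; [apply: stS; rewrite u1 ltnW|apply: stays; rewrite u1].
  by rewrite Rb //=; apply: le_hi.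
have stt : stable (e t) S by apply: stS; rewrite t0t leqnn.
have cross := crossing_mixing ab LS stt leaves HL HR.
have lp : 0 < #|L|%:R :> R by rewrite ltr0n card_gt0.
have rp : 0 < #|S :\: L|%:R :> R by rewrite ltr0n card_gt0.
have kp : 0 < k%:R :> R by rewrite ltr0n.
have cp : 0 < 8 * k%:R ^+ 2 * (#|L|%:R * #|S :\: L|%:R) :> R.
  by rewrite !mulr_gt0 ?exprn_gt0.
set Q := \sum_(K in _) _ in cross *; set v := sqdev _ S in gapP *.
have -> : #|S|%:R / (8 * A * k%:R ^+ 2 * (#|L|%:R * #|S :\: L|%:R)) * v =
    #|S|%:R * v / (8 * k%:R ^+ 2 * (#|L|%:R * #|S :\: L|%:R)) / A.
  by field; rewrite !gt_eqF.
rewrite ler_pM2r ?invr_gt0 // ler_pdivrMr //.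
have cp' : 0 <= 4 * k%:R ^+ 2 * (#|L|%:R * #|S :\: L|%:R) :> R.
  by rewrite !mulr_ge0 ?exprn_ge0.
have := ler_wpM2l cp' cross; move: gapP; lra.
Qed.

Variables (M : nat).
Let B := 32 * A * M%:R / s.

(** The outer induction on [k] keeps windows and sets general, since it is applied to the two sides
    on a subwindow; the inner one, on the window length, treats the times after a drop. *)
Lemma energy_bound k t0 t1 S : (0 < k <= M)%N -> S != set0 -> confined k t0 t1 S ->
  \sum_(t0 <= t < t1) energy t S <= (B * #|S|%:R) ^+ k * sqdev (x t0) S `^ s.
Proof.
elim: k t0 t1 S => // j IHk t0 t1 S /= jM S0 cf.
have M0 : (1 <= M)%N by apply: leq_trans jM.
have N1 : 1 <= #|S|%:R :> R by rewrite ler1n card_gt0.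
have BA : 2 * A / s <= B.
  rewrite /B ler_pM2r ?invr_gt0 //.
  have : 1 <= M%:R :> R by rewrite ler1n.
  by have := A1; nra.
have As : 1 <= A / s by rewrite ler_pdivlMr // mul1r; apply: le_trans A1.
have B1 : 1 <= B by apply: le_trans BA; rewrite -mulrA; lra.
have [j0|j0] := posnP j.
  subst j; apply: le_trans (energy_one S0 cf) _; rewrite expr1.
  apply: ler_wpM2r; first exact: powR_ge0.
  by apply: le_trans BA _; rewrite ler_peMr //; lra.
have IH t2 t3 X : X != set0 -> confined j t2 t3 X ->
    \sum_(t2 <= t < t3) energy t X <= (B * #|X|%:R) ^+ j * sqdev (x t2) X `^ s.
  by apply: IHk; rewrite j0 ltnW.
have B0 : 0 < B by lra.
have BN1 : 1 <= B * #|S|%:R by apply: mulr_ege1.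
(* With at most [j] vertices there are at most [j] components. Otherwise [j < #|S|], as
   [split_budget] requires. *)
have [Nj|jN] := leqP #|S| j.
  apply: le_trans (IH _ _ _ S0 _) _.
    by move=> t /cf[st _]; split=> //; apply: leq_trans (card_comps_in st) Nj.
  by apply: ler_wpM2r; rewrite ?powR_ge0 // ler_weXn2l.
have BNj : B * #|S|%:R <= (B * #|S|%:R) ^+ j by apply: ler_eXnr.
have F0 : 0 <= (B * #|S|%:R) ^+ j.+1 by rewrite exprn_ge0 // mulr_ge0; lra.
have [n] := ubnP (t1 - t0)%N; elim: n t0 cf => // n IHt t0 cf tn.
have [le10|lt01] := leqP t1 t0.
  by rewrite big_geq // mulr_ge0 ?powR_ge0.
have IHt' t : (t0 <= t < t1)%N -> \sum_(t.+1 <= u < t1) energy u S <=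
    (B * #|S|%:R) ^+ j.+1 * sqdev (x t.+1) S `^ s.
  move=> /andP[r1 r2]; apply: IHt.
    by apply: confinedW cf; rewrite // ltnW.
  by move: tn r1 r2; clear; lia.
have [V0|V0] := leP (sqdev (x t0) S) 0.
  by apply: le_trans (energy_const V0 cf) _; rewrite mulr_ge0 ?powR_ge0.
have [st0 c0] : stable (e t0) S /\ (#|comps_in (e t0) S| <= j.+1)%N.
  by apply: cf; rewrite leqnn.
have Mk : j.+1%:R <= M%:R :> R by rewrite ler_nat.
have k0 : 0 < j.+1%:R :> R by rewrite ltr0n.
have [mix|[L [a [b [[LS L0 R0 stL ab] [La Rb gapP]]]]]] :=
    mix_or_split (y := x t0) (@e_sym t0) st0 c0 S0 V0.
  have tr : (t0 <= t0 < t1)%N by rewrite leqnn.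
  have N0 : 0 < #|S|%:R :> R by lra.
  (* The drop occurs at [t0] itself, so the preceding window is empty and costs nothing. *)
  apply: (energy_tail (theta := (4 * A * j.+1%:R * #|S|%:R)^-1) (cost := 0) tr cf V0 F0).
  - by rewrite invr_ge0 !mulr_ge0 // ltW.
  - rewrite mulrC ler_pdivrMr; last by rewrite !mulr_gt0.
    apply: le_trans mix _; rewrite le_eqVlt; apply/orP; left; apply/eqP.
    by field; rewrite gt_eqF.
  - rewrite add0r exprS.
    have -> : B * #|S|%:R * (B * #|S|%:R) ^+ j * (s / 2) * (4 * A * j.+1%:R * #|S|%:R)^-1 =
        4 * (M%:R / j.+1%:R) * (B * #|S|%:R) ^+ j.
      by rewrite {1}/B; field; rewrite !gt_eqF.
    apply: (@le_trans _ _ (1 * (1 * #|S|%:R))); first by rewrite !mul1r ler_nat.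
    apply: ler_pM => //.
      have Mk1 : 1 <= M%:R / j.+1%:R :> R by rewrite ler_pdivlMr // mul1r.
      by move: (_ / _) Mk1 => r; lra.
    by apply: le_trans BNj; apply: ler_wpM2r B1; rewrite ltW.
  - by rewrite big_geq // mul0r.
  - exact: IHt'.
have L1 : (0 < #|L|)%N by rewrite card_gt0.
have R1 : (0 < #|S :\: L|)%N by rewrite card_gt0.
have EN : #|S| = (#|L| + #|S :\: L|)%N.
  by rewrite -(cardsID L S) (setIidPr LS).
have splitP t : (t <= t1)%N -> (forall u, (t0 <= u < t)%N -> stable (e u) L) ->
    \sum_(t0 <= u < t) energy u S <=
    ((B * #|L|%:R) ^+ j + (B * #|S :\: L|%:R) ^+ j) * sqdev (x t0) S `^ s.
  move=> tt1 HL; apply: energy_split => //; first exact: ltW.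
    by apply: confinedW cf.
  by move=> X; apply: IH.
have [stays|[t2 [/andP[tr1 tr2] stays leaves]]] :=
    first_failure (fun u => stable (e u) L) t0 t1.
  (* No edge ever crosses: the two sides cost at most [2 * (B * #|S|) ^ j], and [B * #|S| >= 2]. *)
  apply: le_trans (splitP t1 _ stays) _ => //.
  apply: ler_wpM2r; first exact: powR_ge0.
  have le_pow (m : nat) : (m <= #|S|)%N -> (B * m%:R) ^+ j <= (B * #|S|%:R) ^+ j.
    move=> mN; have pos (q : nat) : B * q%:R \is Num.nneg.
      by rewrite nnegrE; apply: mulr_ge0; [exact: ltW|exact: ler0n].
    by apply: lerXn2r; rewrite ?pos // ler_pM2l // ler_nat.
  apply: le_trans (lerD (le_pow _ _) (le_pow _ _)) _.
  - exact: subset_leq_card.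
  - by apply/subset_leq_card/subsetDl.
  rewrite exprS -mulr2n -[leLHS]mulr_natl; apply: ler_wpM2r; first by lra.
  apply: (@le_trans _ _ (1 * #|S|%:R)); first by rewrite mul1r ler_nat (leq_ltn_trans j0).
  by apply: ler_wpM2r B1; lra.
have tr : (t0 <= t2 < t1)%N by rewrite tr1.
have jN' : (j < #|L| + #|S :\: L|)%N by rewrite -EN.
have := split_budget A1 s01 (erefl B) j0 jM L1 R1 jN'; rewrite -EN => budget.
apply: (energy_tail tr cf V0 F0 _ _ budget) => //.
- by rewrite divr_ge0 // !mulr_ge0 ?exprn_ge0 // ltW.
- apply: (@split_mixing t0 t2 S L a b j.+1) => // u /andP[u1 u2].
  by apply: (cf u _).1; rewrite u1 (leq_ltn_trans u2).
- by apply: splitP; rewrite // ltnW.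
- exact: IHt'.
Qed.
End Energy.

(** * Blocks *)

(** The shares [a / (a + b)] and [b / (a + b)] sum to 1, and each is at most its own power of
    exponent [s]. *)
Lemma powRD_le (R : realType) (a b s : R) : 0 <= a -> 0 <= b -> 0 < s <= 1 ->
  (a + b) `^ s <= a `^ s + b `^ s.
Proof.
move=> a0 b0 /andP[s0 s1].
have [->|an0] := eqVneq a 0; first by rewrite add0r powR0 ?add0r // gt_eqF.
have [->|bn0] := eqVneq b 0; first by rewrite addr0 powR0 ?addr0 // gt_eqF.
have ap : 0 < a by rewrite lt_def an0.
have bp : 0 < b by rewrite lt_def bn0.
have c0 : 0 < a + b by rewrite addr_gt0.
have part c : 0 < c -> c <= a + b -> c / (a + b) * (a + b) `^ s <= c `^ s.
  move=> cp cab; have -> : c `^ s = (c / (a + b)) `^ s * (a + b) `^ s.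
    by rewrite -powRM ?divfK ?gt_eqF // ?divr_ge0 // ltW.
  apply: ler_wpM2r; first exact: powR_ge0.
  by apply: ger1_powR => //; rewrite divr_gt0 //= ler_pdivrMr // mul1r.
have := lerD (part a ap _) (part b bp _).
rewrite -mulrDl -mulrDl divff ?gt_eqF // mul1r; apply; first by rewrite lerDl.
by rewrite lerDr.
Qed.

Lemma powR_sum_le (R : realType) (I : Type) (r : seq I) (P : pred I) (f : I -> R) (s : R) :
  0 < s <= 1 -> (forall i, P i -> 0 <= f i) ->
  (\sum_(i <- r | P i) f i) `^ s <= \sum_(i <- r | P i) f i `^ s.
Proof.
move=> s01 f0; elim: r => [|i r IH].
  by rewrite !big_nil powR0 // gt_eqF //; case/andP: s01.
rewrite !big_cons; case: ifP => // Pi.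
apply: le_trans (powRD_le _ _ s01) _; [exact: f0|exact: sumr_ge0|].
by rewrite lerD2l.
Qed.

Lemma count_le1 (T : eqType) (r : seq T) (P : pred T) : uniq r ->
  (forall p q, P p -> P q -> p = q) -> (count P r <= 1)%N.
Proof.
move=> ur H; elim: r ur => //= p r IH /andP[pr /IH {}IH].
case Pp: (P p) => //=.
suff -> : count P r = 0%N by [].
apply/eqP; rewrite -leqn0 leqNgt -has_count; apply/negP => /hasP[q qr Pq].
by move: pr; rewrite (H _ _ Pp Pq) qr.
Qed.

Section Blocks.
Variables (R : realType) (n : nat) (adj : nat -> rel 'I_n) (x : nat -> 'I_n -> R).
Variable t : nat.
Hypothesis e_sym : symmetric (adj t).
Let e := adj t.
Let y := x t.
Let U := edge_union adj x t.

(** Two intervals of [U] meeting at [c] form one interval of [U], which maximality forbids to exceed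
    the block. *)
Lemma block_absorbs (a b p q c : R) : is_block U a b -> a <= c <= b -> p <= c <= q ->
  (forall z, p <= z <= q -> U z) -> a <= p /\ q <= b.
Proof.
move=> [ab [abU mx]] /andP[ac cb] /andP[pc cq] pqU.
have [|||<- <-] := mx (Num.min a p) (Num.max b q).
- by rewrite ge_min lexx.
- by rewrite le_max lexx.
- move=> z /andP[]; rewrite ge_min le_max => /orP z1 /orP z2.
  have [zc|cz] := leP z c.
    case: z1 => z1; first by apply: abU; rewrite z1 (le_trans zc).
    by apply: pqU; rewrite z1 (le_trans zc).
  case: z2 => z2; first by apply: abU; rewrite z2 andbT (le_trans ac) // ltW.
  by apply: pqU; rewrite z2 andbT (le_trans pc) // ltW.
- by split; rewrite ?ge_min ?le_max lexx orbT.
Qed.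

Lemma block_unique (a b a' b' c : R) : is_block U a b -> is_block U a' b' ->
  a <= c <= b -> a' <= c <= b' -> (a, b) = (a', b').
Proof.
move=> B B' c1 c2.
have [a1 b1] := block_absorbs B c1 c2 B'.2.1.
have [a2 b2] := block_absorbs B' c2 c1 B.2.1.
by congr (_, _); apply/le_anti; rewrite ?a1 ?b1 ?a2 ?b2.
Qed.

Lemma edge_interval i j z : i != j -> e i j ->
  Num.min (y i) (y j) <= z <= Num.max (y i) (y j) -> U z.
Proof. by move=> ij eij zr; exists i, j. Qed.

Definition inside (a b : R) : {set 'I_n} := [set v | a <= y v <= b].

Lemma edge_inside a b i j c : is_block U a b -> i != j -> e i j -> a <= c <= b ->
  Num.min (y i) (y j) <= c <= Num.max (y i) (y j) -> i \in inside a b /\ j \in inside a b.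
Proof.
move=> B ij eij ca ci.
have [m1 m2] := block_absorbs B ca ci (fun z => edge_interval ij eij (z := z)).
move: m1 m2; rewrite le_min ge_max => /andP[? ?] /andP[? ?].
by rewrite !inE; split; apply/andP.
Qed.

Lemma stable_inside a b : is_block U a b -> stable e (inside a b).
Proof.
move=> B; suff H i j : e i j -> i \in inside a b -> j \in inside a b.
  by move=> i j ij; apply/idP/idP; apply: H => //; rewrite /e e_sym.
move=> eij iS; have [<-//|ij] := eqVneq i j.
have [||//] := edge_inside B ij eij (c := y i); first by move: iS; rewrite inE.
by rewrite ge_min le_max lexx.
Qed.

(** In [covering], no gap separates the ends of a block: the edge over the middle of such a gap
    would join its two sides, against [stable_below]. *)
Lemma block_length i0 j0 : is_block U (y i0) (y j0) ->
  y j0 - y i0 <= \sum_(K in comps_in e (inside (y i0) (y j0))) diam y K.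
Proof.
move=> B; set S := inside _ _; have st := stable_inside B.
have ij0 : y i0 <= y j0 by case: B.
have iS : i0 \in S by rewrite inE lexx.
have jS : j0 \in S by rewrite inE lexx ij0.
have [P0 PS PC] := comps_in_family st.
have := covering y P0 PS PC jS iS; rewrite ger0_norm ?subr_ge0 //.
rewrite [X in _ <= _ + X]big1 ?addr0 // => K KP; apply/eqP; rewrite mulf_eq0.
case: (boolP (separates y S K j0 i0)) => [sep|]; last by rewrite eqxx orbT.
rewrite oner_eq0 orbF; apply: contraT => gn0.
have g0 : 0 < gap y (comps_in e S) S K by rewrite lt_def gn0 gap_ge0.
have stb := stable_below e_sym st g0.
have far v w : v \in below y S K -> w \in S -> w \notin below y S K ->
    y v <= hi y K /\ hi y K + gap y (comps_in e S) S K <= y w.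
  by move=> vb wS wb; apply: (gap_below g0 vb); rewrite inE wb.
have [i0b j0b] : i0 \in below y S K /\ j0 \notin below y S K.
  move: sep; rewrite /separates; case: (boolP (j0 \in _)) => jb.
    case: (boolP (i0 \in _)) => ib //= _.
    by have [] := far _ _ jb iS ib; move: ij0 g0; lra.
  by case: (i0 \in _).
have [H1 H2] := far _ _ i0b jS j0b.
(* The midpoint of the gap is taken by no vertex of the block, so an edge covering it must straddle
   it strictly. *)
pose c := hi y K + gap y (comps_in e S) S K / 2.
have cab : y i0 <= c <= y j0 by rewrite /c; apply/andP; split; move: H1 H2 g0; lra.
have [i [j [ij eij cij]]] := B.2.1 c cab.
have [iS' jS'] := edge_inside B ij eij cab cij.
have Eb := stb _ _ eij.
have side v : v \in S -> (v \in below y S K) = (y v <= c).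
  move=> vS; case: (boolP (v \in _)) => vb; apply/esym.
    by have [+ _] := far _ _ vb jS j0b; rewrite /c; move: g0; lra.
  by apply/negbTE; rewrite -ltNge; have [_] := far _ _ i0b vS vb; rewrite /c; move: g0; lra.
have off v : v \in S -> y v != c.
  move=> vS; apply/eqP => vc; case: (boolP (v \in below y S K)) => vb.
    by have [] := far _ _ vb jS j0b; move: vc g0; rewrite /c; lra.
  by have [] := far _ _ i0b vS vb; move: vc g0; rewrite /c; lra.
move: Eb; rewrite !side //; move: cij; rewrite ge_min le_max.
by have := off _ iS'; have := off _ jS'; case: (ltgtP (y j) c); case: (ltgtP (y i) c).
Qed.

(** Subadditivity of the power passes from blocks to their components. Distinct blocks are disjoint,
    so each component is charged at most once. *)
Lemma Est_le_diam s : 0 < s <= 1 ->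
  Est adj x s t <= \sum_(K in comps_in e [set: 'I_n]) diam y K `^ s.
Proof.
move=> s01; rewrite /Est.
set vals := undup _; have uv : uniq vals by apply: undup_uniq.
have stT : stable e [set: 'I_n] by move=> i j _; rewrite !inE.
pose P := comps_in e [set: 'I_n].
have P0 K : K \in P -> K != set0 by case: (comps_in_family stT) => + _ _; apply.
pose bl (a b : R) := `[< is_block U a b >].
apply: (@le_trans _ _ (\sum_(a <- vals) \sum_(b <- vals)
    \sum_(K in P) diam y K `^ s * (bl a b && (K \subset inside a b))%:R)).
  rewrite big_seq [leRHS]big_seq; apply: ler_sum => a av.
  rewrite big_seq [leRHS]big_seq; apply: ler_sum => b bv.
  rewrite /bl; case: asboolP => B /=; last first.
    by apply: sumr_ge0 => K _; rewrite mulr0.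
  move: av bv; rewrite !mem_undup => /mapP[i _ Ea] /mapP[j _ Eb].
  rewrite Ea Eb in B *.
  have i0 K : K \in comps_in e (inside (x t i) (x t j)) -> 0 <= diam y K.
    by move=> KP; apply: diam_ge0; case: (comps_in_family (stable_inside B)) => + _ _; apply.
  apply: (@le_trans _ _ ((\sum_(K in comps_in e (inside (x t i) (x t j))) diam y K) `^ s)).
    apply: ge0_ler_powR; rewrite ?nnegrE.
    - by case/andP: s01 => /ltW.
    - by rewrite subr_ge0; case: B.
    - exact: sumr_ge0.
    - exact: block_length.
  apply: le_trans (powR_sum_le _ _ i0) _ => //.
  rewrite big_mkcond [leRHS]big_mkcond; apply: ler_sum => K _.
  rewrite !inE subsetT andbT; case: (K \in conn_comps e) => //=.
  by case: ifP; rewrite ?mulr1 ?mulr0.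
under eq_bigr do rewrite exchange_big /=.
rewrite exchange_big /=; apply: ler_sum => K KP.
under eq_bigr do rewrite -mulr_sumr.
rewrite -mulr_sumr ler_piMr ?powR_ge0 //.
pose here (p : R * R) := bl p.1 p.2 && (K \subset inside p.1 p.2).
have -> : \sum_(a <- vals) \sum_(b <- vals) (bl a b && (K \subset inside a b))%:R =
    (count here [seq (a, b) | a <- vals, b <- vals])%:R :> R.
  transitivity (\sum_(p <- [seq (a, b) | a <- vals, b <- vals]) (here p)%:R : R).
    by rewrite big_allpairs.
  by rewrite -natr_sum -sum1_count [in RHS]big_mkcond.
rewrite -[1]/(1%:R) ler_nat.
apply: count_le1; first by apply: allpairs_uniq => // -[? ?] [? ?] _ _ [-> ->].
move=> [a b] [a' b'] /= /andP[/asboolP B KS] /andP[/asboolP B' KS'].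
have /set0Pn[i iK] := P0 _ KP.
have := subsetP KS _ iK; have := subsetP KS' _ iK; rewrite !inE => c' c.
exact: block_unique c c'.
Qed.

End Blocks.

(** * Expanding averaging systems *)

Section System.
Variables (R : realType) (n d : nat) (h : R).
Variables (adj : nat -> rel 'I_n) (x : nat -> 'I_n -> R).
Hypothesis n2 : (2 <= n)%N.
Hypothesis d2 : (2 <= d)%N.
Hypothesis h0 : 0 < h.
Hypothesis sys : expanding_averaging_system adj d h.
Hypothesis dyn : averaging_dynamics adj d x.
Implicit Types (S K X : {set 'I_n}) (t : nat).

Let loops t i : adj t i i.
Proof. by case: sys => /(_ t)[H _] _ _; apply: H. Qed.

Let adj_sym t : symmetric (adj t).
Proof. by case: sys => /(_ t)[_ H] _ _. Qed.

Let d0 : (0 < d)%N. Proof. exact: ltnW. Qed.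
Let dp : 0 < d%:R :> R. Proof. by rewrite ltr0n. Qed.

Lemma card_nbrs t i : #|nbrs (adj t) i| = d.
Proof.
case: sys => _ /(_ t i) H _; apply/eqP; rewrite -(eqr_nat R) -H.
apply/eqP; rewrite -sum1_card natr_sum big_mkcond /=; apply: eq_bigr => j _.
by rewrite mxE inE; case: (adj t i j).
Qed.

Lemma dynE t i : x t.+1 i = (\sum_(j in nbrs (adj t) i) x t j) / d%:R.
Proof.
rewrite dyn mulr_suml [RHS]big_mkcond /=; apply: eq_bigr => j _.
by rewrite mxE inE; case: (adj t i j); rewrite ?mul0r // mul1r mulrC.
Qed.

Lemma boundary_edgesE t X : (boundary_edges adj t X)%:R = outflow R (adj t) X.
Proof.
pose out i j : R := [&& adj t i j, i \in X & j \notin X]%:R.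
transitivity (\sum_(p : 'I_n * 'I_n) out p.1 p.2).
  rewrite /boundary_edges -sum1_card natr_sum big_mkcond; apply: eq_bigr => p _.
  by rewrite inE /out; case: [&& _, _ & _].
rewrite -(pair_bigA _ out); apply: eq_bigr => i _; rewrite [RHS]big_mkcond.
by apply: eq_bigr => j _; rewrite inE /out; case: (adj t i j).
Qed.

(** As [d >= 2], a vertex has a neighbour besides itself, so alone it is at most half of its
    component; at most [d] edges leave it. *)
Lemma expansion_le_degree : h <= d%:R.
Proof.
pose i : 'I_n := Ordinal (ltnW n2); set e := adj 0.
have [j ij ji] : exists2 j, e i j & j != i.
  have /card_gt0P[j] : (0 < #|nbrs e i :\ i|)%N.
    have := cardsD1 i (nbrs e i); rewrite card_nbrs inE /e loops add1n => E.
    by move: d2; rewrite E.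
  by rewrite !inE => /andP[ji ij]; exists j.
case: sys => _ _ /(_ 0%N (conn_comp e i)) H.
have {}H : h * #|[set i]|%:R <= (boundary_edges adj 0 [set i])%:R.
  apply: H; first by apply/imsetP; exists i.
    by rewrite sub1set mem_comp.
  rewrite cards1 muln1 (cardsD1 i) mem_comp; apply/card_gt0P; exists j.
  by rewrite !inE ji connect1.
move: H; rewrite cards1 mulr1 boundary_edgesE => /le_trans; apply.
rewrite /outflow (bigD1 i) //= [X in _ + X]big1 ?addr0 => [|k ki]; last first.
  by rewrite big1 // => l _; rewrite inE (negbTE ki).
rewrite -natr_sum ler_nat -(card_nbrs 0 i) -sum1_card.
by apply: leq_sum => k _; case: (_ && _).
Qed.

(** The product of [d^2] from [sqdev_dissipation] and [4 d / h^2] from [cheeger_component]. *)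
Definition mixing_const : R := 4 * d%:R ^+ 3 / h ^+ 2.

Lemma mixing_const_ge1 : 1 <= mixing_const.
Proof.
rewrite /mixing_const ler_pdivlMr ?exprn_gt0 // mul1r.
apply: (@le_trans _ _ (d%:R ^+ 2)).
  by rewrite ler_sqr ?nnegrE ?expansion_le_degree // ltW.
have d1 : 1 <= d%:R :> R by rewrite ler1n.
have := exprn_ge0 2 (ltW dp); rewrite [_ ^+ 3]exprS; nra.
Qed.

Lemma system_mixing t S : stable (adj t) S -> sqdev (x t.+1) S <=
  sqdev (x t) S - (\sum_(K in comps_in (adj t) S) sqdev (x t) K) / mixing_const.
Proof.
move=> st.
have := sqdev_dissipation (@adj_sym t) (card_nbrs t) d0 (@loops t) st (dynE t).
rewrite -(sum_comps (@adj_sym t) _ st).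
set D := \sum_(K in _) _; set Q := \sum_(K in _) sqdev (x t) K => H.
have HD : h ^+ 2 * Q <= 4 * d%:R * D.
  rewrite /Q /D !mulr_sumr; apply: ler_sum => K /(comps_inP _ st)[i iS ->].
  apply: (cheeger_component (@adj_sym t) (card_nbrs t) _ h0 d0).
    exact: stable_comp.
  move=> X XK cX; rewrite -boundary_edgesE; case: sys => _ _ /(_ t (conn_comp (adj t) i)) Hc.
  by apply: Hc => //; apply/imsetP; exists i.
have D2 : 0 < d%:R ^+ 2 :> R by rewrite exprn_gt0.
rewrite -(ler_pM2l D2); apply: le_trans H _; rewrite mulrBr lerD2l lerN2.
have -> : d%:R ^+ 2 * (Q / mixing_const) = h ^+ 2 * Q / (4 * d%:R).
  by rewrite /mixing_const; field; rewrite !gt_eqF.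
by rewrite ler_pdivrMr ?mulr_gt0 // [leRHS]mulrC.
Qed.

Lemma system_hull_le t S c : stable (adj t) S ->
  (forall i, i \in S -> x t i <= c) -> forall i, i \in S -> x t.+1 i <= c.
Proof.
move=> st H i iS; rewrite dynE ler_pdivrMr //.
apply: (@le_trans _ _ (\sum_(j in nbrs (adj t) i) c)).
  by apply: ler_sum => j; rewrite inE => /st ij; apply: H; rewrite -ij.
by rewrite sumr_const card_nbrs mulr_natr.
Qed.

Lemma system_hull_ge t S c : stable (adj t) S ->
  (forall i, i \in S -> c <= x t i) -> forall i, i \in S -> c <= x t.+1 i.
Proof.
move=> st H i iS; rewrite dynE ler_pdivlMr //.
apply: (@le_trans _ _ (\sum_(j in nbrs (adj t) i) c)); last first.
  by apply: ler_sum => j; rewrite inE => /st ij; apply: H; rewrite -ij.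
by rewrite sumr_const card_nbrs mulr_natr.
Qed.

Lemma sqdev_init : normalized_init d (x 0%N) -> sqdev (x 0%N) [set: 'I_n] <= 1.
Proof.
rewrite /normalized_init -mulr_sumr => H.
have -> : sqdev (x 0%N) [set: 'I_n] = \sum_i (x 0%N i - mean (x 0%N)) ^+ 2.
  rewrite /sqdev /avg /mean cardsT card_ord.
  have -> : \sum_(i in [set: 'I_n]) x 0%N i = \sum_i x 0%N i.
    by apply: eq_bigl => i; rewrite inE.
  by apply: eq_bigl => i; rewrite inE.
apply: le_trans H; rewrite ler_peMl ?ler1n //.
by apply: sumr_ge0 => i _; apply: sqr_ge0.
Qed.

(** Write [diam^s] as [(diam^2)^(s / 2)], apply [diam_sqdev], and bound [2^(s / 2)] by 2. *)
Lemma Est_le_energy s t : 0 < s <= 1 ->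
  Est adj x s t <= 2 * energy adj x (s / 2) t [set: 'I_n].
Proof.
move=> s01; have [s0 s1] := andP s01.
apply: le_trans (Est_le_diam x (@adj_sym t) s01) _.
have stT : stable (adj t) [set: 'I_n] by move=> i j _; rewrite !inE.
rewrite /energy mulr_sumr; apply: ler_sum => K KP.
have K0 : K != set0 by case: (comps_in_family stT) => + _ _; apply.
have sE : s = 2%:R * (s / 2) by field.
rewrite {1}sE powRrM powR_mulrn ?diam_ge0 //.
apply: (@le_trans _ _ ((2 * sqdev (x t) K) `^ (s / 2))).
  apply: ge0_ler_powR; rewrite ?nnegrE ?sqr_ge0 ?diam_sqdev //.
    by rewrite divr_ge0 // ltW.
  by rewrite mulr_ge0 ?sqdev_ge0.
rewrite powRM ?sqdev_ge0 //; apply: ler_wpM2r; first exact: powR_ge0.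
by apply: ler1_powR; rewrite ?ler1n //; lra.
Qed.

Lemma Est_ge0 s t : 0 <= Est adj x s t.
Proof.
rewrite /Est; apply: sumr_ge0 => a _; apply: sumr_ge0 => b _.
by case: ifP => // _; apply: powR_ge0.
Qed.

Lemma Es_le s c : (forall T, \sum_(0 <= t < T) Est adj x s t <= c) ->
  (Es adj x s <= c%:E)%E.
Proof.
move=> H; rewrite /Es; apply: lime_le.
  by apply: is_cvg_nneseries => t _ _; rewrite lee_fin Est_ge0.
by apply: nearW => T; rewrite sumEFin lee_fin.
Qed.

Lemma Es_le_energy s F : 0 < s <= 1 -> normalized_init d (x 0%N) -> 0 <= F ->
    (forall T, \sum_(0 <= t < T) energy adj x (s / 2) t [set: 'I_n] <=
      F * sqdev (x 0%N) [set: 'I_n] `^ (s / 2)) ->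
  (Es adj x s <= (2 * F)%:E)%E.
Proof.
move=> s01 init F0 H; apply: Es_le => T.
apply: (@le_trans _ _ (2 * \sum_(0 <= t < T) energy adj x (s / 2) t [set: 'I_n])).
  by rewrite mulr_sumr; apply: ler_sum => t _; apply: Est_le_energy.
rewrite ler_pM2l //; apply: le_trans (H T) _; rewrite ler_piMr //.
have [s0 _] := andP s01.
have E1 : 1 `^ (s / 2) = 1 :> R by rewrite powR1.
rewrite -[leRHS]E1.
apply: ge0_ler_powR; rewrite ?nnegrE ?sqdev_ge0 ?sqdev_init //.
by rewrite divr_ge0 // ltW.
Qed.

Lemma confined_all m T : at_most_components adj m -> confined adj m 0 T [set: 'I_n].
Proof.
move=> H t _; split; first by move=> i j _; rewrite !inE.
apply: leq_trans (H t); apply/subset_leq_card/subsetP => K.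
by rewrite inE => /andP[].
Qed.

End System.

Theorem theorem1 :
  exists C : Rdefinitions.R, 0 < C /\
  forall (n d : nat) (h s : Rdefinitions.R),
    (2 <= n)%N -> (2 <= d)%N -> 0 < h -> 0 < s <= 1 ->
    forall (adj : nat -> rel 'I_n) (x : nat -> 'I_n -> Rdefinitions.R),
      expanding_averaging_system adj d h ->
      averaging_dynamics adj d x ->
      normalized_init d (x 0%N) ->
      (at_most_components adj 1 ->
         (Es adj x s <= (C * d%:R ^+ 3 / (s * h ^+ 2))%:E)%E) /\
      (forall m : nat, (1 <= m <= n.-1)%N -> at_most_components adj m ->
         (Es adj x s <=
            (((C * d%:R ^+ 3 * m%:R * n%:R / h ^+ 2) / s) ^+ m)%:E)%E).
Proof.
(* In the bound for [m] components, 512 collects 2 from [Est_le_energy], 32 from [B], 4 from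
   [mixing_const] and 2 from halving [s]; the connected case needs only 32. *)
exists 512; split; first by rewrite ltr0n.
move=> n d h s n2 d2 h0 s01 adj x sys dyn init.
have [s0 s1] := andP s01.
have s201 : 0 < s / 2 <= 1 by apply/andP; split; lra.
have adj_sym t : symmetric (adj t) by case: sys => /(_ t)[_ H] _ _.
have dp : 0 < d%:R :> Rdefinitions.R by rewrite ltr0n ltnW.
set A := mixing_const d h.
have A1 : 1 <= A := mixing_const_ge1 n2 d2 h0 sys.
have A0 : 0 < A by lra.
have s20 : 0 <= s / 2 by lra.
have mix := system_mixing d2 h0 sys dyn.
have hle := system_hull_le d2 sys dyn; have hge := system_hull_ge d2 sys dyn.
have V0 : [set: 'I_n] != set0.
  by apply/set0Pn; exists (Ordinal (ltnW n2)).
split=> [H1|m mn Hm].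
  have F0 : 0 <= 2 * A / (s / 2) by apply: divr_ge0 => //; rewrite mulr_ge0 // ltW.
  have HT T := energy_one adj_sym A1 s201 mix V0 (@confined_all _ adj 1 T H1).
  apply: le_trans (Es_le_energy d2 sys s01 init F0 HT) _; rewrite lee_fin.
  have -> : 2 * (2 * A / (s / 2)) = 32 * (d%:R ^+ 3 / (s * h ^+ 2)).
    by rewrite /A /mixing_const; field; rewrite !gt_eqF.
  rewrite -mulrA; apply: ler_wpM2r; last by lra.
  by rewrite divr_ge0 ?exprn_ge0 ?mulr_ge0 ?exprn_ge0 // ltW.
have m1 : (0 < m <= m)%N by rewrite leqnn andbT; case/andP: mn.
pose B := 32 * A * m%:R / (s / 2).
have B0 : 0 <= B.
  by apply: divr_ge0 s20; apply: mulr_ge0; [apply: mulr_ge0; rewrite ?ltW|exact: ler0n].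
have HT T := energy_bound adj_sym A1 s201 mix hle hge m1 V0 (@confined_all _ adj m T Hm).
have F0 : 0 <= (B * n%:R) ^+ m by rewrite exprn_ge0 // mulr_ge0.
rewrite cardsT card_ord -/B in HT.
apply: le_trans (Es_le_energy d2 sys s01 init F0 HT) _; rewrite lee_fin.
have -> : 512 * d%:R ^+ 3 * m%:R * n%:R / h ^+ 2 / s = 2 * (B * n%:R).
  by rewrite /B /A /mixing_const; field; rewrite !gt_eqF.
(* The outer factor 2 moves inside the power because [2 <= 2 ^ m]. *)
rewrite [leRHS]exprMn; apply: ler_wpM2r => //.
by apply: ler_eXnr; [case/andP: m1|lra].
Qed.
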